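(* Let $(S,M)$ be a marked surface without punctures, $T$ a triangulation of $(S,M)$, and $\zeta$ an essential loop in $(S,M)$. There is a bijection $\psi_{\zeta}:\mathbb{P}_g(\widetilde{G}_{\zeta})\to\mathbb{A}_g(T_{\zeta})$ satisfying $x(P)=x(\psi_{\zeta}(P))$ and $y(P)=y(\psi_{\zeta}(P))$ for all $P\in\mathbb{P}_g(\widetilde{G}_{\zeta})$. In particular, $$x_{\zeta}=\frac{1}{\operatorname{cross}(T,\zeta)}\sum_{A\in\mathbb{A}_g(T_{\zeta})}x(A)y(A).$$
   Context: A marked surface without punctures: $S$ is a connected compact oriented surface with boundary and $M$ a finite set of marked points on $\partial S$, at least one on each boundary component (not a monogon, digon or triangle). $T=\{1,\dots,N\}$ is a triangulation (maximal set of pairwise non-crossing arcs) with initial variables $x_i$ and coefficients $y_i$. An essential loop $\zeta$ is a closed curve in $S$ up to isotopy, disjoint from $M$ and $\partial S$, without self-intersection, and not contractible (taken to cross $T$ minimally). Cutting $\zeta$. Choose a triangle $\triangle$ of $T$ crossed by $\zeta$ and a point $p$ on $\zeta$ in the interior of $\triangle$. Let $\alpha$ (resp. $\beta$) be the side of $\triangle$ crossed by $\zeta$ immediately before (resp. after) $p$, and $\tau$ the third side. $\widetilde\zeta$ is the curve from $p$ to $p$ following $\zeta$. Let $\tau_1=\beta,\dots,\tau_n=\alpha$ be the arcs crossed in order and $\triangle_0=\triangle,\triangle_1,\dots,\triangle_n=\triangle$ the triangles passed through. $T_{\widetilde\zeta}$ is the triangulated polygon obtained from copies of $\triangle_0,\dots,\triangle_n$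 by gluing $\triangle_{i-1},\triangle_i$ along $\tau_i$. Snake graph $G_{\widetilde\zeta}$: tile $i$ is the 4-cycle bounding $\triangle_{i-1}\cup\triangle_i$ (with diagonal $\tau_i$); tiles $i$ and $i+1$ are glued along the side of $\triangle_i$ other than $\tau_i,\tau_{i+1}$, matching endpoints. Edges of $G_{\widetilde\zeta}$ are labelled by the corresponding arcs of $T$ or boundary segments. In the first triangle, $v$ (resp. $w$) is the common endpoint of $\tau$ and $\alpha$ (resp. $\tau$ and $\beta$); in the last triangle, $v'$ (resp. $w'$) is the common endpoint of $\tau$ and $\beta$ (resp. $\tau$ and $\alpha$). Band graph $\widetilde G_\zeta$: obtained from $G_{\widetilde\zeta}$ by identifying the edge $\tau$ of the first tile with the edge $\tau$ of the last tile so that $v$ is identified with $v'$ (and $w$ with $w'$). A perfect matching $P$ of $\widetilde G_\zeta$ (set of edges covering each vertex exactly once) is good if $\tau\in P$, or if the edges of $P$ incident to $v$ and to $w$ both lie on the same square (both on the first tile or both on the last tile of $G_{\widetilde\zeta}$). $\mathbb{P}_g(\widetilde G_\zeta)$ is the set of good perfect matchings. For such $P$, viewed as edges of $G_{\widetilde\zeta}$ by cutting along $\tau$, $\overline P$ is the perfect matching of $G_{\widetilde\zeta}$ obtained by adding the edge $\tau$ of the first or of the last tile as needed (if $\tau\in P$, $\overline P$ contains both copies of $\tau$). Weights of $P$: $x_e=x_i$ if the edge $e$ is labelled by an arc $i$ of $T$, and $x_e=1$ if by a boundary segment of $(S,M)$; $x(P)=\prod_{e\in P}x_e$. Let $P_-(G_{\widetilde\zeta})$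 be the perfect matching of $G_{\widetilde\zeta}$ consisting only of boundary edges (edges lying in exactly one tile) and containing the edge of the first tile corresponding to the side of the first triangle that follows $\tau_1$ clockwise. $P_-(G_{\widetilde\zeta})\triangle\overline P$ (symmetric difference) is the set of boundary edges of a union of tiles; $y(P):=\prod y_j$ over the diagonals $j$ of these tiles. $\operatorname{cross}(T,\zeta)=\prod_{i=1}^n x_{\tau_i}$, and $x_\zeta:=\frac{1}{\operatorname{cross}(T,\zeta)}\sum_{P\in\mathbb{P}_g(\widetilde G_\zeta)}x(P)y(P)$. Triangulated annulus $T_\zeta$: glue copies of $\triangle_1,\dots,\triangle_n$ cyclically along $\tau_1,\dots,\tau_n$ (with $\triangle_n$ glued to $\triangle_1$ along $\tau_1$); the diagonals are $\tau_1,\dots,\tau_n$, the other edges are boundary segments of the annulus. $\mathbb{A}(T_\zeta)$ is the set of perfect matchings of angles: sets $A$ of angles of triangles with exactly one angle of $A$ at each vertex (incident to a diagonal) and exactly one in each triangle. An angle of $A$ at a boundary vertex $v$ satisfies the min-condition (resp. max-condition) if it comes first in the counterclockwise (resp. clockwise) order around $v$. $A$ is bad if all its angles at vertices of one boundary component satisfy the min-condition and all its angles at vertices of the other boundary component satisfy the max-condition; otherwise good. $\mathbb{A}_g(T_\zeta)$ is the set of good ones. $x(A)=\prod_{a\in A}x_a$ with $x_a=x_\sigma$ for $\sigma$ the side opposite $a$ in its triangle ($x_\sigma=1$ for boundary segments of $(S,M)$). $A_-(T_\zeta)$ is the perfect matching of angles all of whose angles satisfy the min-condition, and $y(A)=\prod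 y_\sigma$ over the diagonals $\sigma$ of $T_\zeta$ that are sides of at least one exterior angle (angle between a boundary segment and a diagonal of $T_\zeta$) belonging to $A_-(T_\zeta)\triangle A$.
   Formalization: When τ is not in P, ''good'' is read as: the edges of P at v and w lie on the same side of the cut along τ (at the first-tile or last-tile copy of τ), possibly on the adjacent tile; requiring them to be on the first or last tile itself makes the bijection fail. *)

(* Defs.v *)
From mathcomp Require Import all_boot all_order all_algebra.
Set Implicit Arguments.
Unset Strict Implicit.
Unset Printing Implicit Defensive.
Import Order.TTheory GRing.Theory Num.Theory.
Local Open Scope ring_scope.

(******************************************************************************)
(* Triangulated surfaces are encoded combinatorially, as oriented triangles   *)
(* glued along sides. The sides of a triangle t are (t, k) with k : 'I_3,     *)
(* numbered counterclockwise; corner (t, k) is the vertex of t opposite to    *)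
(* side (t, k). Hence, with ordS k = k + 1 and ord_pred k = k - 1 modulo 3:   *)
(*  - side (t, k), followed with t on its left, goes from corner              *)
(*    (t, ordS k) to corner (t, ord_pred k);                                  *)
(*  - turning counterclockwise around corner (t, k) inside t leads from side  *)
(*    (t, ord_pred k) to side (t, ordS k).                                    *)
(* A gluing identifies two sides so that orientations match: the start of one *)
(* is the end of the other.                                                   *)
(******************************************************************************)

(* The corner which follows c counterclockwise around its vertex, when the    *)
(* side (c.1, ordS c.2) separating them is glued to another one.              *)
Definition next_corner (tri : Type) (glue : tri * 'I_3 -> tri * 'I_3)
    (c : tri * 'I_3) : tri * 'I_3 :=
  let s := glue (c.1, ordS c.2) in (s.1, ordS s.2).

(* A triangulation, with arcs 1, ..., N, of a marked surface without          *)
(* punctures. The fixed points of glue are the boundary segments, and the     *)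
(* marked points are the classes of corners under the gluings. no_puncture    *)
(* says that turning around any vertex one meets the boundary, i.e. that all  *)
(* the vertices lie on the boundary of the surface. Since monogons and digons *)
(* have no triangulation into triangles, only the triangle is excluded.       *)
Record triangulation (N : nat) := Triangulation {
  tri : finType;
  glue : tri * 'I_3 -> tri * 'I_3;
  label : tri * 'I_3 -> option 'I_N;
  glueK : involutive glue;
  label_boundary : forall s, (label s == None) = (glue s == s);
  label_glue : forall s s', label s != None ->
    (label s' == label s) = (s' == s) || (s' == glue s);
  label_onto : forall i, exists s, label s = Some i;
  tri_connected : forall t t',
    connect [rel u u' | [exists k, (glue (u, k)).1 == u']] t t';
  no_puncture : forall c, exists m,
    let c' := iter m (next_corner glue) c in
    glue (c'.1, ordS c'.2) = (c'.1, ordS c'.2);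
  not_triangle : (1 < #|tri|)%N
}.

(* Position on the boundary circle of a triangle, parametrized by [0, 3], of  *)
(* the point at distance r from the start of side k.                          *)
Definition circle_pos (k : 'I_3) (r : rat) : rat := (k : nat)%:R + r.

Definition between (a b c : rat) : bool := Num.min a b < c < Num.max a b.

(* The chords ab and cd of a circle cross.                                    *)
Definition chords_cross (a b c d : rat) : bool :=
  between a b c (+) between a b d.

(* A closed curve transverse to the triangulation is given by the cyclic      *)
(* sequence ex of the sides through which it leaves the triangles it passes   *)
(* through. It is realized without self-intersections when one can place its  *)
(* crossings with the arcs (the i-th one at distance q i from the start of    *)
(* ex i, hence at distance 1 - q i from the start of glue (ex i)) at          *)
(* pairwise distinct points, in such a way that the segments of the curve     *)
(* inside each triangle do not cross. Segment i goes from crossing i to       *)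
(* crossing ordS i.                                                           *)
Definition simple_drawing N (T : triangulation N) (m : nat)
    (ex : 'I_m.+1 -> tri T * 'I_3) (q : 'I_m.+1 -> rat) : Prop :=
  let inpos i := circle_pos (glue (ex i)).2 (1 - q i) in
  let outpos i := circle_pos (ex (ordS i)).2 (q (ordS i)) in
  [/\ forall i, 0 < q i < 1,
      forall i j, i != j -> ex i = ex j -> q i != q j,
      forall i j, i != j -> ex i = glue (ex j) -> q i != 1 - q j
    & forall i j, i != j -> (ex (ordS i)).1 = (ex (ordS j)).1 ->
        ~~ chords_cross (inpos i) (outpos i) (inpos j) (outpos j)].

(* An essential loop, with an orientation and a base point p chosen in one of *)
(* the triangles it crosses. It crosses n = len.+1 arcs; exit i is the side   *)
(* through which it leaves the i-th triangle, 0 <= i < n, so that in the      *)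
(* usual notation exit i is tau_(i+1), seen as a side of Delta_i, and p lies  *)
(* in Delta_0 = Delta_n. Crossing the triangulation minimally means not       *)
(* leaving a triangle through the side of entry; such a closed curve with at  *)
(* least one crossing is not contractible, and conversely.                    *)
Record essential_loop N (T : triangulation N) := EssentialLoop {
  len : nat;
  exit : 'I_len.+1 -> tri T * 'I_3;
  exit_arc : forall i, glue (exit i) != exit i;
  exit_next : forall i, (exit (ordS i)).1 = (glue (exit i)).1;
  exit_reduced : forall i, exit (ordS i) != glue (exit i);
  exit_simple : exists q, simple_drawing exit q
}.

Notation ncross z := (len z).+1.

(* The sides of the copy of the triangle Delta_j, 0 <= j < n, (with           *)
(* Delta_n = Delta_0) through which the loop enters and leaves, and its third *)
(* side.                                                                      *)
Definition exit_side N (T : triangulation N) (z : essential_loop T)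
  (j : 'I_(ncross z)) : 'I_3 := (exit j).2.

Definition entry_side N (T : triangulation N) (z : essential_loop T)
  (j : 'I_(ncross z)) : 'I_3 := (glue (exit (ord_pred j))).2.

Definition third_side N (T : triangulation N) (z : essential_loop T)
    (j : 'I_(ncross z)) : 'I_3 :=
  odflt ord0 [pick k | (k != entry_side j) && (k != exit_side j)].

Definition side_label N (T : triangulation N) (z : essential_loop T)
  (j : 'I_(ncross z)) (k : 'I_3) : option 'I_N := label ((exit j).1, k).

Definition weight N (F : fieldType) (x : 'I_N -> F) (o : option 'I_N) : F :=
  oapp x 1 o.

Definition cross N (T : triangulation N) (z : essential_loop T)
    (F : fieldType) (x : 'I_N -> F) : F :=
  \prod_(i < ncross z) weight x (label (exit i)).

(******************************************************************************)
(* Snake and band graphs. Tile i (0 <= i < n, the diagonal being tau_(i+1))   *)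
(* is made of a first half, a copy of Delta_i, and a second half, a copy of   *)
(* Delta_(i+1); halves are indexed by false and true respectively.            *)
(******************************************************************************)

Definition half_tri N (T : triangulation N) (z : essential_loop T)
  (i : 'I_(ncross z)) (h : bool) : 'I_(ncross z) := if h then ordS i else i.

Definition diag_side N (T : triangulation N) (z : essential_loop T)
    (i : 'I_(ncross z)) (h : bool) : 'I_3 :=
  if h then entry_side (ordS i) else exit_side i.

(* (i, h, c) is the corner c of the half h of tile i. The vertices of the     *)
(* graphs are classes of such triples.                                        *)
Definition tile_corner N (T : triangulation N) (z : essential_loop T) :
  finType := ('I_(ncross z) * bool * 'I_3)%type.

(* A graph built from the tiles: distinct edges of the tiles can only be      *)
(* identified when they are third sides of triangles, third_edge i h being    *)
(* the edge given by the third side of the half h of tile i; corner_glue      *)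
(* generates the identifications of vertices.                                 *)
Record tiled_graph N (T : triangulation N) (z : essential_loop T) :=
  TiledGraph {
    third_edges : finType;
    third_edge : 'I_(ncross z) -> bool -> third_edges;
    corner_glue : rel (tile_corner z)
  }.

(* inl (i, false) and inl (i, true) are the edges of tile i labelled by the   *)
(* arcs tau_i and tau_(i+2), which are sides of its first and second half.    *)
Definition edge N (T : triangulation N) (z : essential_loop T)
    (G : tiled_graph z) : finType :=
  (('I_(ncross z) * bool) + third_edges G)%type.

(* The edge given by the side k of the half h of tile i, if not the diagonal. *)
Definition tile_edge N (T : triangulation N) (z : essential_loop T)
    (G : tiled_graph z) (i : 'I_(ncross z)) (h : bool) (k : 'I_3) : edge G :=
  if k == third_side (half_tri i h) then inr (third_edge G i h)
  else inl (i, h).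

Definition on_tile N (T : triangulation N) (z : essential_loop T)
    (G : tiled_graph z) (i : 'I_(ncross z)) (e : edge G) : bool :=
  [exists h, exists k, (k != diag_side i h) && (tile_edge G i h k == e)].

Definition same_vertex N (T : triangulation N) (z : essential_loop T)
    (G : tiled_graph z) : rel (tile_corner z) :=
  connect [rel u v | corner_glue G u v || corner_glue G v u].

Definition incident N (T : triangulation N) (z : essential_loop T)
    (G : tiled_graph z) (e : edge G) (v : tile_corner z) : bool :=
  [exists i, exists h, exists k, exists c,
    [&& k != diag_side i h, tile_edge G i h k == e, c != k
      & same_vertex G (i, h, c) v]].

Definition perfect_matching N (T : triangulation N) (z : essential_loop T)
    (G : tiled_graph z) (P : {set edge G}) : bool :=
  [forall v, #|[set e in P | incident e v]| == 1%N].

(* Identifications of the corners of the tiles in the snake graph: the two    *)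
(* halves of a tile are glued along the diagonal, and consecutive tiles are   *)
(* glued along the third side of the triangle of which they both contain a    *)
(* copy (the endpoints of this side being the corners other than the opposite *)
(* one).                                                                      *)
Definition snake_glue N (T : triangulation N) (z : essential_loop T) :
    rel (tile_corner z) := fun u v =>
  let: (i, h, c) := u in let: (i', h', c') := v in
  [|| [&& i == i', ~~ h, h', c == ordS (diag_side i false)
        & c' == ord_pred (diag_side i true)],
      [&& i == i', ~~ h, h', c == ord_pred (diag_side i false)
        & c' == ordS (diag_side i true)]
    | [&& i' == i.+1 :> nat, h, ~~ h', c == c' & c != third_side i']].

(* Let alpha, beta and tau be the entry, exit and third sides of Delta_0. The *)
(* common endpoint of two sides is the corner opposite to the other one:      *)
(* v = tau /\ alpha and w = tau /\ beta are taken in the first tile,          *)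
(* v' = tau /\ beta and w' = tau /\ alpha in the last tile.                   *)
Definition vertex_v N (T : triangulation N) (z : essential_loop T) :
  tile_corner z := (ord0, false, exit_side (@ord0 (len z))).

Definition vertex_w N (T : triangulation N) (z : essential_loop T) :
  tile_corner z := (ord0, false, entry_side (@ord0 (len z))).

Definition vertex_v' N (T : triangulation N) (z : essential_loop T) :
  tile_corner z := (ord_max, true, entry_side (@ord0 (len z))).

Definition vertex_w' N (T : triangulation N) (z : essential_loop T) :
  tile_corner z := (ord_max, true, exit_side (@ord0 (len z))).

Definition band_glue N (T : triangulation N) (z : essential_loop T) :
    rel (tile_corner z) := fun u v =>
  [|| snake_glue u v, (u == vertex_v z) && (v == vertex_v' z)
    | (u == vertex_w z) && (v == vertex_w' z)].

(* The third sides of Delta_0, ..., Delta_n give n.+1 edges of the snake      *)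
(* graph; those of Delta_0 and Delta_n (both labelled by tau) become the same *)
(* edge of the band graph.                                                    *)
Definition snake N (T : triangulation N) (z : essential_loop T) :
    tiled_graph z :=
  @TiledGraph N T z 'I_(ncross z).+1
    (fun i h => if h then lift ord0 i else widen_ord (leqnSn _) i)
    (@snake_glue N T z).

Definition band N (T : triangulation N) (z : essential_loop T) :
    tiled_graph z :=
  @TiledGraph N T z 'I_(ncross z) (@half_tri N T z) (@band_glue N T z).

Definition tau_first N (T : triangulation N) (z : essential_loop T) :
  edge (snake z) := inr ord0.

Definition tau_last N (T : triangulation N) (z : essential_loop T) :
  edge (snake z) := inr ord_max.

Definition tau_band N (T : triangulation N) (z : essential_loop T) :
  edge (band z) := inr ord0.

(* The projection of the snake graph onto the band graph, on edges (inZp is   *)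
(* the reduction modulo n).                                                   *)
Definition snake_to_band N (T : triangulation N) (z : essential_loop T)
    (e : edge (snake z)) : edge (band z) :=
  match e with inl a => inl a | inr j => inr (inZp j) end.

Definition edge_label N (T : triangulation N) (z : essential_loop T)
    (e : edge (band z)) : option 'I_N :=
  match e with
  | inl (i, false) => side_label i (entry_side i)
  | inl (i, true) => side_label (ordS i) (exit_side (ordS i))
  | inr j => side_label j (third_side j)
  end.

(* P viewed as a set of edges of the snake graph.                             *)
Definition cut N (T : triangulation N) (z : essential_loop T)
    (P : {set edge (band z)}) : {set edge (snake z)} :=
  [set e | snake_to_band e \in P].

(* The edges of P incident to v and to w in the band graph all lie on the     *)
(* side of the first (resp. last) tile of the cut along tau: in the snake     *)
(* graph, they are incident to v or w in the first tile (resp. to v' or w' in *)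
(* the last tile). Such an edge need not belong to the first (resp. last)     *)
(* tile itself, because a vertex of tau may be shared with the next tile.     *)
Definition first_side N (T : triangulation N) (z : essential_loop T)
    (P : {set edge (band z)}) : bool :=
  [forall e in cut P,
    (incident (snake_to_band e) (vertex_v z)
      || incident (snake_to_band e) (vertex_w z)) ==>
    (incident e (vertex_v z) || incident e (vertex_w z))].

Definition last_side N (T : triangulation N) (z : essential_loop T)
    (P : {set edge (band z)}) : bool :=
  [forall e in cut P,
    (incident (snake_to_band e) (vertex_v z)
      || incident (snake_to_band e) (vertex_w z)) ==>
    (incident e (vertex_v' z) || incident e (vertex_w' z))].

Definition good_matchings N (T : triangulation N) (z : essential_loop T) :
    {set {set edge (band z)}} :=
  [set P | perfect_matching P &&
           [|| tau_band z \in P, first_side P | last_side P]].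

Definition extend N (T : triangulation N) (z : essential_loop T)
    (P : {set edge (band z)}) : {set edge (snake z)} :=
  if tau_band z \in P then cut P
  else if last_side P then tau_first z |: cut P
  else tau_last z |: cut P.

Definition boundary_edges N (T : triangulation N) (z : essential_loop T)
    (J : {set 'I_(ncross z)}) : {set edge (snake z)} :=
  [set e | #|[set i in J | on_tile i e]| == 1%N].

(* The side of Delta_0 which follows exit 0 clockwise.                        *)
Definition clockwise_edge N (T : triangulation N) (z : essential_loop T) :
    edge (snake z) :=
  tile_edge (snake z) ord0 false (ord_pred (exit_side (@ord0 (len z)))).

(* There is exactly one such matching; set0 is a dummy value.                 *)
Definition P_minus N (T : triangulation N) (z : essential_loop T) :
    {set edge (snake z)} :=
  odflt set0 [pick P | [&& perfect_matching P, P \subset boundary_edges setT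
                         & clockwise_edge z \in P]].

Definition symdiff (U : finType) (A B : {set U}) : {set U} :=
  (A :\: B) :|: (B :\: A).

(* The tiles enclosed by the symmetric difference of P_minus and extend P;    *)
(* they are determined by their boundary, and set0 is a dummy value.          *)
Definition enclosed_tiles N (T : triangulation N) (z : essential_loop T)
    (P : {set edge (band z)}) : {set 'I_(ncross z)} :=
  odflt set0 [pick J | boundary_edges J == symdiff (P_minus z) (extend P)].

Definition x_matching N (T : triangulation N) (z : essential_loop T)
    (F : fieldType) (x : 'I_N -> F) (P : {set edge (band z)}) : F :=
  \prod_(e in P) weight x (edge_label e).

Definition y_matching N (T : triangulation N) (z : essential_loop T)
    (F : fieldType) (y : 'I_N -> F) (P : {set edge (band z)}) : F :=
  \prod_(i in enclosed_tiles P) weight y (label (exit i)).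

Definition x_loop N (T : triangulation N) (z : essential_loop T)
    (F : fieldType) (x y : 'I_N -> F) : F :=
  (cross z x)^-1 *
    \sum_(P in good_matchings z) x_matching x P * y_matching y P.

(******************************************************************************)
(* The triangulated annulus, made of the copies of Delta_0, ..., Delta_(n-1)  *)
(* glued cyclically. The angle (j, k) is the angle at the corner k of         *)
(* Delta_j, so that it is opposite to the side k. The diagonals are the entry *)
(* and exit sides, the boundary segments the third sides; in particular every *)
(* vertex is incident to a diagonal.                                          *)
(******************************************************************************)

Definition angle N (T : triangulation N) (z : essential_loop T) : finType :=
  ('I_(ncross z) * 'I_3)%type.

Definition annulus_glue N (T : triangulation N) (z : essential_loop T) :
    rel (angle z) := fun a b =>
  (b.1 == ordS a.1) &&
  ((a.2 == ordS (exit_side a.1)) && (b.2 == ord_pred (entry_side b.1))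
   || (a.2 == ord_pred (exit_side a.1)) && (b.2 == ordS (entry_side b.1))).

Definition annulus_vertex N (T : triangulation N) (z : essential_loop T) :
    rel (angle z) :=
  connect [rel a b | annulus_glue a b || annulus_glue b a].

(* The corners a and b belong to the same component of the boundary of the    *)
(* annulus, i.e. are related by a path of boundary segments.                  *)
Definition same_component N (T : triangulation N) (z : essential_loop T) :
    rel (angle z) :=
  connect [rel a b | annulus_vertex a b
    || [&& a.1 == b.1, a.2 != third_side a.1 & b.2 != third_side b.1]].

Definition angle_matching N (T : triangulation N) (z : essential_loop T)
    (A : {set angle z}) : bool :=
  [forall v, #|[set a in A | annulus_vertex v a]| == 1%N] &&
  [forall j, #|[set a in A | a.1 == j]| == 1%N].

(* The angle comes first in the counterclockwise (resp. clockwise) order      *)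
(* around its vertex.                                                         *)
Definition min_condition N (T : triangulation N) (z : essential_loop T)
  (a : angle z) : bool := ord_pred a.2 == third_side a.1.

Definition max_condition N (T : triangulation N) (z : essential_loop T)
  (a : angle z) : bool := ordS a.2 == third_side a.1.

Definition bad N (T : triangulation N) (z : essential_loop T)
    (A : {set angle z}) : bool :=
  [exists u, exists v, ~~ same_component u v &&
    [forall a in A, (same_component u a ==> min_condition a) &&
                    (same_component v a ==> max_condition a)]].

Definition good_angle_matchings N (T : triangulation N)
    (z : essential_loop T) : {set {set angle z}} :=
  [set A | angle_matching A && ~~ bad A].

Definition A_minus N (T : triangulation N) (z : essential_loop T) :
  {set angle z} := [set a | min_condition a].

(* An exterior angle lies between a boundary segment and a diagonal.          *)
Definition exterior N (T : triangulation N) (z : essential_loop T)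
  (a : angle z) : bool := a.2 != third_side a.1.

(* The i-th diagonal (exit i) is a side of the angle a.                       *)
Definition diagonal_of N (T : triangulation N) (z : essential_loop T)
    (i : 'I_(ncross z)) (a : angle z) : bool :=
  (a.1 == i) && (a.2 != exit_side i)
  || (a.1 == ordS i) && (a.2 != entry_side (ordS i)).

Definition x_angles N (T : triangulation N) (z : essential_loop T)
    (F : fieldType) (x : 'I_N -> F) (A : {set angle z}) : F :=
  \prod_(a in A) weight x (side_label a.1 a.2).

Definition y_angles N (T : triangulation N) (z : essential_loop T)
    (F : fieldType) (y : 'I_N -> F) (A : {set angle z}) : F :=
  \prod_(i < ncross z | [exists a in symdiff (A_minus z) A,
                           exterior a && diagonal_of i a])
    weight y (label (exit i)).

(* Main.v *)
(* Send an edge of the band graph to the angle opposite to it in its triangle.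
   This is a bijection between the edges of the band graph and the angles of
   the annulus which preserves the weights x, and it induces psi on sets. Write
   E_j, X_j, H_j for the angles of Delta_j opposite to the entry, exit and
   third sides. On both sides, being good turns out to be equivalent to the same
   local conditions: one element in each triangle, and E_j (+) X_(j+1) = 1
   exactly when the loop turns in the same direction in Delta_j and Delta_(j+1).
   For the band graph, the vertex equations force the numbers of edges in
   consecutive triangles to add up to 2 away from the cut, and goodness says
   that these numbers are 1 next to the cut. For the annulus, the number of ends
   of the j-th diagonal which have their angle in an earlier triangle does not
   depend on j; it is 0 or 2 for the two bad matchings, and 1 otherwise. Finally,
   in both definitions of y, the i-th diagonal occurs exactly when the matching
   differs at E_i from the minimal one. *)

Require Import Defs.
From mathcomp Require Import all_boot all_order all_algebra.
Set Implicit Arguments.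
Unset Strict Implicit.
Unset Printing Implicit Defensive.

(** * Cyclic order on three sides, cyclic indices, and counting over explicit lists *)

(** The term [c] has the shape of [third_side], so that the lemma applies to it by conversion. The
    search cannot fail, since two values never exhaust three indices; the rest is enumeration. *)
Lemma ord3_third (a b : 'I_3) (c := odflt ord0 [pick k | (k != a) && (k != b)]) :
  a != b ->
  [/\ (c == a) = false, (c == b) = false &
      forall k, [|| k == a, k == b | k == c]].
Proof.
have dec (d : 'I_3) : d != a -> d != b -> a != b ->
    [/\ (d == a) = false, (d == b) = false & forall k, [|| k == a, k == b | k == d]].
  move=> /negPf da /negPf db ab; split=> // k; move: ab da db.
  clear c; case: a b d k => [[|[|[|a]]] ?] [[|[|[|b]]] ?] [[|[|[|d]]] ?] [[|[|[|k]]] ?] //.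
rewrite /c; case: pickP => [k /andP[] | none ab]; first exact: dec.
have := (none ord0, none (inord 1), none ord_max); move: ab; rewrite -!val_eqE /= inordK //.
by clear; case: a b => [[|[|[|a]]] ?] [[|[|[|b]]] ?] // _ [[]].
Qed.

(** Three distinct indices have only two cyclic orders, and the test [b == ordS a] tells which one
    holds. The product of equations serves as a single rewrite rule. *)
Lemma ord3_rotation (a b c : 'I_3) :
  a != b -> c != a -> c != b ->
  ((ordS a = if b == ordS a then b else c) *
   (ord_pred a = if b == ordS a then c else b) *
   (ordS b = if b == ordS a then c else a) *
   (ord_pred b = if b == ordS a then a else c) *
   (ordS c = if b == ordS a then a else b) *
   (ord_pred c = if b == ordS a then b else a))%type.
Proof.
case: a b c => [[|[|[|a]]] ?] [[|[|[|b]]] ?] [[|[|[|c]]] ?] // _ _ _.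
all: by do !split; apply/eqP.
Qed.

Lemma val_iter_ordS n m (i : 'I_n) : val (iter m (@ordS n) i) = (i + m) %% n.
Proof.
elim: m => [|m IH] /=; first by rewrite addn0 modn_small.
by rewrite IH -addn1 modnDml addn1 addnS.
Qed.

(** The bound on [m] matters: one revolution along the loop meets every triangle. *)
Lemma iter_ordS_onto n (i j : 'I_n) : exists2 m, m < n & iter m (@ordS n) i = j.
Proof.
have n_gt0 : 0 < n by apply: leq_ltn_trans (ltn_ord i).
exists ((j + n - i) %% n); first by rewrite ltn_pmod.
apply: val_inj; rewrite val_iter_ordS modnDmr subnKC ?modnDr ?modn_small //.
by rewrite (leq_trans (ltnW (ltn_ord i))) ?leq_addl.
Qed.

Lemma ordS_ind n (P : 'I_n -> Prop) i :
  P i -> (forall j, P j -> P (ordS j)) -> forall j, P j.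
Proof.
by move=> Pi PS j; have [m _ <-] := iter_ordS_onto i j; elim: m => //= m; apply: PS.
Qed.

Lemma ordS_max n : ordS (@ord_max n) = ord0.
Proof. by apply: val_inj; rewrite /= modnn. Qed.

Lemma ord_pred0 n : ord_pred (@ord0 n) = ord_max.
Proof. by rewrite -ordS_max ordSK. Qed.

Lemma eq_ord_pred n (i j : 'I_n) : (ord_pred i == j) = (i == ordS j).
Proof. by rewrite (can2_eq (@ord_predK _) (@ordSK _)). Qed.

Lemma eq_ordS0 n (i : 'I_n.+1) : (ordS i == ord0) = (i == ord_max).
Proof. by rewrite -ordS_max (inj_eq (@ordS_inj _)). Qed.

Lemma eq_ord_pred_max n (i : 'I_n.+1) : (ord_pred i == ord_max) = (i == ord0).
Proof. by rewrite eq_ord_pred ordS_max. Qed.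

Lemma val_ordS n (i : 'I_n.+1) : i != ord_max -> ordS i = i.+1 :> nat.
Proof.
move=> im /=; rewrite modn_small // ltnS ltn_neqAle -ltnS ltn_ord andbT.
by apply: contraNneq im => h; apply/eqP/val_inj.
Qed.

(** Degree conditions thereby become sums of booleans over explicit lists, which case analysis can
    settle. *)
Lemma card_setI_seq (U : finType) (D : {set U}) (p : pred U) (s : seq U) :
  uniq s -> p =i s -> #|[set e in D | p e]| = count (mem D) s.
Proof.
move=> us ps; rewrite -size_filter -(card_uniqP (filter_uniq _ us)).
by apply: eq_card => e; rewrite !inE mem_filter -ps.
Qed.

Lemma eq_inl (U V : eqType) (a b : U) : (inl a == inl b :> U + V) = (a == b).
Proof. by []. Qed.

Lemma eq_inr (U V : eqType) (a b : V) : (inr a == inr b :> U + V) = (a == b).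
Proof. by []. Qed.

Lemma eq_inlr (U V : eqType) (a : U) (b : V) :
  ((inl a == inr b :> U + V) = false) * ((inr b == inl a :> U + V) = false).
Proof. by []. Qed.

Definition sum_eqE := (eq_inl, eq_inr, eq_inlr).

(** * Triangles along the loop *)

Section Loop.
Context (N : nat) (T : triangulation N) (z : essential_loop T).
Implicit Types (A : {set angle z}) (j i : 'I_(ncross z)) (s : bool) (a b : angle z).

(* The third side of Delta_j lies on the left of the loop. *)
Definition turn j : bool := exit_side j == ordS (entry_side j).

Lemma entry_sideS i : entry_side (ordS i) = (glue (exit i)).2.
Proof. by rewrite /entry_side ordSK. Qed.

Lemma entry_neq_exit j : entry_side j != exit_side j.
Proof.
rewrite -[j]ord_predK entry_sideS /exit_side.
apply: contraNneq (exit_reduced (ord_pred j)) => eq2; apply/eqP.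
by rewrite [LHS]surjective_pairing exit_next -eq2 -surjective_pairing.
Qed.

Lemma third_neq_entry j : (third_side j == entry_side j) = false.
Proof. by have [] := ord3_third (entry_neq_exit j). Qed.

Lemma third_neq_exit j : (third_side j == exit_side j) = false.
Proof. by have [] := ord3_third (entry_neq_exit j). Qed.

Lemma entry_exitF j : (entry_side j == exit_side j) = false.
Proof. exact/negbTE/entry_neq_exit. Qed.

Lemma eq_entry_third j : (entry_side j == third_side j) = false.
Proof. by rewrite eq_sym third_neq_entry. Qed.
Lemma eq_exit_third j : (exit_side j == third_side j) = false.
Proof. by rewrite eq_sym third_neq_exit. Qed.
Lemma eq_exit_entry j : (exit_side j == entry_side j) = false.
Proof. by rewrite eq_sym entry_exitF. Qed.

Definition sidesE := (third_neq_entry, third_neq_exit, entry_exitF,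
  eq_entry_third, eq_exit_third, eq_exit_entry).

Variant side_spec j : 'I_3 -> Type :=
  | SideEntry : side_spec j (entry_side j)
  | SideExit : side_spec j (exit_side j)
  | SideThird : side_spec j (third_side j).

Lemma sideP j k : side_spec j k.
Proof.
have [_ _ /(_ k)] := ord3_third (entry_neq_exit j).
rewrite -/(third_side j).
case: (k =P entry_side j) => [-> | _] /=; first by constructor.
by case: (k =P exit_side j) => [-> | _] /= => [|/eqP ->]; constructor.
Qed.

Lemma rotationE j :
  ((ordS (entry_side j) = if turn j then exit_side j else third_side j) *
   (ord_pred (entry_side j) = if turn j then third_side j else exit_side j) *
   (ordS (exit_side j) = if turn j then third_side j else entry_side j) *
   (ord_pred (exit_side j) = if turn j then entry_side j else third_side j) *
   (ordS (third_side j) = if turn j then entry_side j else exit_side j) *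
   (ord_pred (third_side j) = if turn j then exit_side j else entry_side j))%type.
Proof.
by apply: ord3_rotation; rewrite ?entry_neq_exit ?third_neq_entry ?third_neq_exit.
Qed.

(* The corner of Delta_j at the left (s = true) or right end of its exit side,
   resp. of its entry side. *)
Definition exit_corner j s : 'I_3 := if s == turn j then entry_side j else third_side j.
Definition entry_corner j s : 'I_3 := if s == turn j then exit_side j else third_side j.

(* The boundary component, left or right of the loop, of a corner. *)
Definition on_left a : bool := (a.2 == third_side a.1) (+) turn a.1.

(** Seen while leaving a triangle, a side followed with the triangle on its left runs from right to
    left, so its left end is the corner [ord_pred]. Seen while entering, left and right are
    exchanged, whence the opposite formula for entry sides. *)
Lemma exit_cornerE j s :
  exit_corner j s = if s then ord_pred (exit_side j) else ordS (exit_side j).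
Proof.
by rewrite !rotationE /exit_corner; case: (turn j); case: s.
Qed.

Lemma entry_cornerE j s :
  entry_corner j s = if s then ordS (entry_side j) else ord_pred (entry_side j).
Proof.
by rewrite !rotationE /entry_corner; case: (turn j); case: s.
Qed.

Lemma on_left_entry j : on_left (j, entry_side j) = turn j.
Proof. by rewrite /on_left /= sidesE. Qed.
Lemma on_left_exit j : on_left (j, exit_side j) = turn j.
Proof. by rewrite /on_left /= sidesE. Qed.
Lemma on_left_third j : on_left (j, third_side j) = ~~ turn j.
Proof. by rewrite /on_left /= eqxx. Qed.
Definition on_leftE := (on_left_entry, on_left_exit, on_left_third).

Lemma on_left_exit_corner j s : on_left (j, exit_corner j s) = s.
Proof. by rewrite /exit_corner; case: eqP => [->|]; rewrite on_leftE //;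
  case: s (turn j) => -[]. Qed.

Lemma on_left_entry_corner j s : on_left (j, entry_corner j s) = s.
Proof. by rewrite /entry_corner; case: eqP => [->|]; rewrite on_leftE //;
  case: s (turn j) => -[]. Qed.

Lemma exit_cornerK j k : k != exit_side j -> exit_corner j (on_left (j, k)) = k.
Proof. by case: (sideP j k); rewrite ?eqxx //= on_leftE /exit_corner; case: (turn j). Qed.

Lemma entry_cornerK j k : k != entry_side j -> entry_corner j (on_left (j, k)) = k.
Proof. by case: (sideP j k); rewrite ?eqxx //= on_leftE /entry_corner; case: (turn j). Qed.

Lemma exit_eta j : ((exit j).1, exit_side j) = exit j.
Proof. by rewrite /exit_side -surjective_pairing. Qed.

Lemma entry_eta j : ((exit j).1, entry_side j) = glue (exit (ord_pred j)).
Proof. by rewrite -{1}[j]ord_predK exit_next -surjective_pairing. Qed.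

(* With constant turns the loop would go around a single vertex of T, which
   would be a puncture. *)
Lemma turn_nonconst s : exists j, turn j = s.
Proof.
case: (pickP (fun j => turn j == s)) => [j /eqP | turnN]; first by exists j.
have turnE j : turn j = ~~ s by move: (turnN j); case: (turn j); case: (s).
have [m] := @no_puncture N T ((exit (@ord0 (len z))).1, third_side (@ord0 (len z))).
(* The corners opposite to the third sides all sit at one vertex of [T]. Turning counterclockwise
   around it follows the loop forwards if the third sides are on the right, backwards if they are on
   the left. Every side met is thus crossed by the loop and cannot be a boundary segment. *)
have [j ->] : exists j, iter m (next_corner (@glue _ T)) ((exit (@ord0 (len z))).1,
  third_side (@ord0 (len z)))
    = ((exit j).1, third_side j).
  elim: m => [|m [j IH]] /=; first by exists ord0.
  rewrite IH /next_corner /= rotationE turnE; case: (s) turnE => /= tE.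
    by exists (ordS j); rewrite exit_eta -exit_next -entry_sideS rotationE tE.
  by exists (ord_pred j); rewrite entry_eta glueK -/(exit_side _) rotationE tE.
rewrite /= rotationE turnE; case: (s) => /=.
  by rewrite exit_eta => h; have := exit_arc j; rewrite h eqxx.
by rewrite entry_eta glueK => h; have := exit_arc (ord_pred j); rewrite -h eqxx.
Qed.

(** * Matchings of angles *)

(** The angles at a vertex of the annulus form a fan, listed here in the direction of the loop. A
    corner opposite to the exit side does not touch that diagonal, so the fan ends there; the map is
    made stationary to stay total. [prev_angle] is likewise stationary at the start of the fan. *)
Definition next_angle a : angle z :=
  if a.2 == exit_side a.1 then a
  else (ordS a.1, entry_corner (ordS a.1) (on_left a)).

Definition prev_angle a : angle z :=
  if a.2 == entry_side a.1 then a
  else (ord_pred a.1, exit_corner (ord_pred a.1) (on_left a)).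

Lemma exit_corner_neq j s : (exit_corner j s == exit_side j) = false.
Proof. by rewrite /exit_corner; case: ifP; rewrite sidesE. Qed.

Lemma entry_corner_neq j s : (entry_corner j s == entry_side j) = false.
Proof. by rewrite /entry_corner; case: ifP; rewrite sidesE. Qed.

Lemma eq_exit_corner j s k :
  (k == exit_corner j s) = (k != exit_side j) && (on_left (j, k) == s).
Proof.
apply/eqP/andP => [->|[kx /eqP <-]]; last by rewrite exit_cornerK.
by rewrite exit_corner_neq on_left_exit_corner.
Qed.

Lemma on_left_next a : on_left (next_angle a) = on_left a.
Proof. by rewrite /next_angle; case: ifP => // _; rewrite on_left_entry_corner. Qed.

Lemma next_angleK a : a.2 != exit_side a.1 -> prev_angle (next_angle a) = a.
Proof.
case: a => j k /= kx; rewrite /prev_angle /next_angle /= (negPf kx) /=.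
by rewrite entry_corner_neq ordSK on_left_entry_corner exit_cornerK.
Qed.

Lemma prev_angleK a : a.2 != entry_side a.1 -> next_angle (prev_angle a) = a.
Proof.
case: a => j k /= kx; rewrite /prev_angle /next_angle /= (negPf kx) /=.
by rewrite exit_corner_neq ord_predK on_left_exit_corner entry_cornerK.
Qed.

(** The two cases of [annulus_glue] are the two ends of a diagonal. Gluing is thus the graph of
    [next_angle] away from its fixed points, and vertices can be studied by iteration. *)
Lemma annulus_glueE a b :
  annulus_glue a b = (a.2 != exit_side a.1) && (b == next_angle a).
Proof.
case: a b => [j k] [j' k']; rewrite /annulus_glue /next_angle /=.
have [-> | /=] := eqVneq j' (ordS j); last first.
  by move=> /negPf jj'; case: ifP => // _; rewrite xpair_eqE jj'.
have := (exit_cornerE j true, exit_cornerE j false,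
         entry_cornerE (ordS j) true, entry_cornerE (ordS j) false).
case=> [[[<- <-] <-] <-]; rewrite !eq_exit_corner.
case: ifP => //= _; rewrite xpair_eqE eqxx /=.
by case: on_left => /=; rewrite ?orbF.
Qed.

(** The end of the fan, used as canonical representative of a vertex; [ncross z] steps always
    suffice to reach it. *)
Definition last_angle a : angle z := iter (ncross z) next_angle a.

Lemma iter_next_exit a m : a.2 == exit_side a.1 -> iter m next_angle a = a.
Proof. by move=> ax; elim: m => //= m ->; rewrite /next_angle ax. Qed.

Lemma next_angle_exit a :
  turn (ordS a.1) = on_left a -> (next_angle a).2 == exit_side (next_angle a).1.
Proof.
move=> t; rewrite /next_angle; case: ifP => //= _.
by rewrite /entry_corner t eqxx.
Qed.

(** A fan ends on entering a triangle whose [turn] is the component of the vertex. By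
    [turn_nonconst] there is such a triangle, and it is entered within one revolution. *)
Lemma last_angle_exit a : (last_angle a).2 == exit_side (last_angle a).1.
Proof.
apply: contraT => lastN.
have iterN m : m <= ncross z ->
    (iter m next_angle a).2 != exit_side (iter m next_angle a).1.
  move=> mn; apply: contraNN lastN => h.
  suff -> : last_angle a = iter m next_angle a by [].
  by rewrite -(iter_next_exit (ncross z - m) h) -iterD subnK.
have iter1 m : m <= ncross z -> (iter m next_angle a).1 = iter m (@ordS _) a.1.
  elim: m => //= m IH mn; rewrite -IH 1?ltnW //.
  by rewrite {1}/next_angle (negPf (iterN _ (ltnW mn))).
have iterl m : on_left (iter m next_angle a) = on_left a.
  by elim: m => //= m <-; rewrite on_left_next.
have [j tj] := turn_nonconst (on_left a).
have [m mn mj] := iter_ordS_onto a.1 (ord_pred j).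
have := iterN m.+1 mn; rewrite iterS next_angle_exit //.
by rewrite iterl iter1 1?ltnW // mj ord_predK.
Qed.

Lemma next_exit_corner j s :
  next_angle (ord_pred j, exit_corner (ord_pred j) s) = (j, entry_corner j s).
Proof.
by rewrite /next_angle exit_corner_neq ord_predK on_left_exit_corner.
Qed.

Lemma last_angle_id a : a.2 == exit_side a.1 -> last_angle a = a.
Proof. exact: iter_next_exit. Qed.

Lemma last_angle_next a : last_angle (next_angle a) = last_angle a.
Proof.
rewrite /last_angle -iterSr iterS {1}/next_angle.
by have := last_angle_exit a; rewrite /last_angle => ->.
Qed.

Lemma last_angle_iter m a : last_angle (iter m next_angle a) = last_angle a.
Proof. by elim: m => //= m <-; rewrite last_angle_next. Qed.

Lemma annulus_vertex_sym : symmetric (@annulus_vertex N T z).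
Proof. by apply: sym_connect_sym => a b /=; rewrite orbC. Qed.

Lemma annulus_vertexE a b : annulus_vertex a b = (last_angle a == last_angle b).
Proof.
have step c : annulus_vertex c (next_angle c).
  have [cx | cx] := boolP (c.2 == exit_side c.1).
    by rewrite /next_angle cx; apply: connect0.
  by apply: connect1; rewrite /= annulus_glueE cx eqxx.
have stepl m c : annulus_vertex c (iter m next_angle c).
  elim: m => [|m IH] /=; first exact: connect0.
  exact: connect_trans IH (step _).
apply/idP/eqP => [/connectP[p] | eab].
  elim: p a => [|c p IH] a /=; first by move=> _ ->.
  move=> /andP[h /IH{}IH] /IH <-; case/orP: h; rewrite annulus_glueE => /andP[_ /eqP ->];
    by rewrite last_angle_next.
apply: connect_trans (stepl (ncross z) a) _; rewrite -/(last_angle a) eab.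
by rewrite -/(annulus_vertex _ _) annulus_vertex_sym; apply: stepl.
Qed.

Definition one_per_vertex (A : {set angle z}) : Prop :=
  forall v, #|[set a in A | annulus_vertex v a]| = 1.

(* u j s says whether the vertex of the annulus at the end s of the j-th exit
   side has its angle of A in Delta_j or before, going along the loop. *)
Definition vertex_state (A : {set angle z}) (u : 'I_(ncross z) -> bool -> bool) : Prop :=
  [/\ forall j, ((j, entry_side j) \in A) = u j (turn j),
      forall j, ((j, exit_side j) \in A) = ~~ u (ord_pred j) (turn j)
    & forall j, u j (~~ turn j) =
        u (ord_pred j) (~~ turn j) + ((j, third_side j) \in A) :> nat].

Lemma vertex_state_one_per_vertex A u : vertex_state A u -> one_per_vertex A.
Proof.
move=> [uE uX uH] v.
(* [inn a] and [out a] say whether the vertex of [a] is already matched before and after passing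
   [a]. The values 0 at the first angle of a fan and 1 at the last one are its initial and final
   states. *)
pose out a : nat := if a.2 == exit_side a.1 then 1 else u a.1 (on_left a).
pose inn a : nat := if a.2 == entry_side a.1 then 0 else u (ord_pred a.1) (on_left a).
have outE a : out a = (a \in A) + inn a.
  case: a => j k; rewrite /out /inn /=.
  case: (sideP j k); rewrite ?sidesE ?eqxx ?on_leftE ?uE ?uX ?uH ?addn0 //.
    by case: (u _ _).
  by rewrite addnC.
pose C a := annulus_vertex v a.
(* next_angle matches the terms out a with the terms inn b, so that the sum of
   their differences around a vertex telescopes. *)
have : \sum_(a | C a) out a = 1 + \sum_(a | C a) inn a.
  rewrite (bigID (fun a => a.2 == exit_side a.1)) /=.
  rewrite (big_pred1 (last_angle v)) => [|a]; last first.
    rewrite /C annulus_vertexE; apply/andP/eqP => [[/eqP -> /last_angle_id -> //]|->].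
    by rewrite [last_angle (last_angle v)]last_angle_id ?last_angle_exit ?eqxx.
  rewrite {1}/out last_angle_exit; congr addn.
  rewrite [RHS](bigID (fun a => a.2 == entry_side a.1)) /=.
  rewrite [X in _ = X + _]big1 ?add0n => [|a /andP[_]]; last by rewrite /inn => ->.
  rewrite [RHS](reindex_onto next_angle prev_angle) => [|a /andP[_]];
    last exact: prev_angleK.
  apply: eq_big => [a|a /andP[_ ax]]; last first.
    by rewrite /out /inn /next_angle (negPf ax) /= entry_corner_neq ordSK
      on_left_entry_corner.
  rewrite /C !annulus_vertexE last_angle_next; case: eqP => //= _.
  have [ax | ax] := boolP (a.2 == exit_side a.1); last first.
    by rewrite next_angleK // eqxx /next_angle (negPf ax) /= entry_corner_neq.
  rewrite /next_angle ax /=; apply/esym/andP => -[ae /eqP]; rewrite /prev_angle (negPf ae).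
  move=> h; have := congr1 snd h => /= h2; move: ax; rewrite -h /= => /eqP.
  by move=> h3; have := exit_corner_neq (ord_pred a.1) (on_left a); rewrite h3 eqxx.
rewrite (eq_bigr (fun a => (a \in A) + inn a)) // big_split /= => /eqP.
rewrite eqn_add2r => /eqP A1; rewrite -[RHS]A1 -sum1_card big_mkcond /= [RHS]big_mkcond /=.
by apply: eq_bigr => a _; rewrite inE andbC /C; case: annulus_vertex; case: (_ \in _).
Qed.

(** The state after an angle [a] is whether the unique angle of [A] at its vertex comes at or before
    [a] in the fan, i.e. reaches [a] under [next_angle]. *)
Lemma one_per_vertex_state A : one_per_vertex A -> exists u, vertex_state A u.
Proof.
move=> A1.
pose out a := [exists b in A, fconnect next_angle b a].
have fconnect_last a b : fconnect next_angle a b -> last_angle a = last_angle b.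
  by move=> /iter_findex <-; rewrite last_angle_iter.
have uniqA a b : a \in A -> b \in A -> last_angle a = last_angle b -> a = b.
  move=> aA bA ab; have /eqP/cards1P[c cE] := A1 a.
  have : (a \in [set c]) && (b \in [set c]).
    by rewrite -cE !inE aA bA !annulus_vertexE ab eqxx.
  by rewrite !inE => /andP[/eqP -> /eqP ->].
have acyclic a : a.2 != exit_side a.1 -> ~~ fconnect next_angle (next_angle a) a.
  move=> ax; apply/negP => h.
  have [m mE] : exists m, iter m.+1 next_angle a = a.
    by exists (findex next_angle (next_angle a) a); rewrite iterSr iter_findex.
  (* The number of iterations is a multiple of the period, so it fixes [a], and at least [ncross z],
     so it reaches the end of the fan. *)
  have : iter (m.+1 * ncross z) next_angle a = a.
    elim: (ncross z) => [|k IH]; first by rewrite muln0.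
    by rewrite mulnS iterD IH.
  rewrite mulSn iterD -/(last_angle _) => aE; move: ax.
  by rewrite -aE last_angle_exit.
have outE j : out (j, entry_side j) = ((j, entry_side j) \in A).
  apply/exists_inP/idP => [[b bA /iter_findex] | eA]; last by exists (j, entry_side j).
  case: findex => [<- //|m] /=; rewrite /next_angle; case: ifP => [bx h|_ h].
    by move: bx; rewrite h /= sidesE.
  have := congr1 fst h => /= j1; have := congr1 snd h => /= j2.
  by have := entry_corner_neq (ordS (iter m next_angle b).1) (on_left (iter m next_angle
    b)); rewrite j2 j1 eqxx.
have outX j : out (j, exit_side j).
  have /eqP/cards1P[b /setP/(_ b)] := A1 (j, exit_side j).
  rewrite !inE eqxx => /andP[bA]; rewrite annulus_vertexE last_angle_id //= => /eqP bE.
  by apply/exists_inP; exists b => //; rewrite bE; apply: fconnect_iter.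
have outS a : a.2 != exit_side a.1 ->
    out (next_angle a) = out a + (next_angle a \in A) :> nat.
  move=> ax.
  have -> : out (next_angle a) = out a || (next_angle a \in A).
    apply/exists_inP/orP => [[b bA /iter_findex] | [/exists_inP[b bA ba] | nA]].
    - elim: findex => [<-|m IH]; first by right.
      rewrite iterS; set c := iter m _ _ in IH *.
      have [cx | cx] := boolP (c.2 == exit_side c.1).
        by rewrite [X in X = _]/next_angle cx.
      move=> h; left; apply/exists_inP; exists b => //.
      by rewrite -(next_angleK ax) -h next_angleK // fconnect_iter.
    - exists b => //; apply: connect_trans ba _; exact: fconnect1.
    - by exists (next_angle a).
  (* The two alternatives exclude each other, which turns the disjunction into a sum: otherwise the
     angle of [A] reaching [a] would be [next_angle a], closing a cycle. *)
  case: (boolP (out a)) => //= [/exists_inP[b bA ba]]; case: (boolP (_ \in A)) => //= nA.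
  have bE : b = next_angle a by apply: uniqA => //;
    rewrite last_angle_next (fconnect_last _ _ ba).
  by have := acyclic a ax; rewrite -bE ba.
exists (fun j s => out (j, exit_corner j s)); split=> j.
- by rewrite /exit_corner eqxx outE.
- have := outS (ord_pred j, exit_corner (ord_pred j) (turn j)).
  rewrite next_exit_corner exit_corner_neq /entry_corner eqxx outX => /(_ isT).
  by case: (out _); case: (_ \in _).
- have := outS (ord_pred j, exit_corner (ord_pred j) (~~ turn j)).
  rewrite next_exit_corner exit_corner_neq /entry_corner /exit_corner.
  by case: (turn j) => /= ->.
Qed.

(** * Boundary components of the annulus and good matchings of angles *)

(** Gluings and boundary segments both preserve [on_left]. Conversely, the ends on a given side of
    the successive diagonals are linked all the way around, and every corner is linked to one of
    them. *)
Lemma same_componentE a b : same_component a b = (on_left a == on_left b).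
Proof.
have csym : symmetric (@same_component N T z).
  apply: sym_connect_sym => c d /=; rewrite annulus_vertex_sym; congr (_ || _).
  by rewrite eq_sym; congr (_ && _); rewrite andbC.
apply/idP/eqP => [/connectP[p] | eab].
  elim: p a => [|c p IH] a /=; first by move=> _ ->.
  move=> /andP[h /IH{}IH] /IH <-; case/orP: h; last first.
    case: a c {IH} => [j k] [j' k'] /= /and3P[/eqP <-].
    by rewrite /on_left /= => /negPf -> /negPf ->.
  rewrite annulus_vertexE => /eqP lac.
  have lastl d : on_left (last_angle d) = on_left d.
    by rewrite /last_angle; elim: (ncross z) => //= m <-; rewrite on_left_next.
  by rewrite -lastl lac lastl.
set s := on_left b in eab.
have vert c d : annulus_vertex c d -> same_component c d.
  by move=> cd; apply: connect1; rewrite /= cd.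
have seg j k k' : k != third_side j -> k' != third_side j -> same_component (j, k) (j, k').
  by move=> h h'; apply: connect1; rewrite /= eqxx h h' orbT.
have inside j : same_component (j, entry_corner j s) (j, exit_corner j s).
  rewrite /entry_corner /exit_corner; case: ifP => _; last exact: connect0.
  by apply: seg; rewrite sidesE.
have across j : same_component (j, exit_corner j s) (ordS j, entry_corner (ordS j) s).
  by apply: vert; rewrite -next_exit_corner ordSK annulus_vertexE last_angle_next.
have all j i : same_component (j, exit_corner j s) (i, exit_corner i s).
  have [m _ <-] := iter_ordS_onto j i; elim: m => [|m IH] /=; first exact: connect0.
  exact: connect_trans IH (connect_trans (across _) (inside _)).
have toexit c : on_left c = s -> same_component c (c.1, exit_corner c.1 s).
  case: c => j k <-; have [-> | kx] := eqVneq k (exit_side j).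
    by rewrite on_left_exit /exit_corner eqxx; apply: seg; rewrite sidesE.
  by rewrite exit_cornerK //; apply: connect0.
apply: connect_trans (toexit _ eab) (connect_trans (all _ b.1) _).
by rewrite -/(same_component _ _) csym; apply: toexit.
Qed.

(** Combined with [on_left], on the left component minimal angles are those opposite to entry sides
    and maximal ones those opposite to exit sides; on the right it is the reverse. A bad matching
    therefore uses only entry sides or only exit sides. *)
Lemma min_conditionE j k :
  min_condition (j, k) = (k == if turn j then entry_side j else exit_side j).
Proof.
rewrite /min_condition /=.
by case: (sideP j k); rewrite rotationE; case: (turn j); rewrite ?sidesE ?eqxx.
Qed.

Lemma max_conditionE j k :
  max_condition (j, k) = (k == if turn j then exit_side j else entry_side j).
Proof.
rewrite /max_condition /=.
by case: (sideP j k); rewrite rotationE; case: (turn j); rewrite ?sidesE ?eqxx.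
Qed.

Definition coherent (A : {set angle z}) : Prop :=
  (forall j, ((j, entry_side j) \in A) + ((j, exit_side j) \in A)
             + ((j, third_side j) \in A) = 1) /\
  (forall j, ((j, entry_side j) \in A) (+) ((ordS j, exit_side (ordS j)) \in A)
             = (turn j == turn (ordS j))).

Lemma card_triangle_angles A j :
  #|[set a in A | a.1 == j]| =
    ((j, entry_side j) \in A) + ((j, exit_side j) \in A) + ((j, third_side j) \in A).
Proof.
rewrite (@card_setI_seq _ _ _
  [:: (j, entry_side j); (j, exit_side j); (j, third_side j)]) /=.
- by rewrite addn0 addnA.
- by rewrite !inE !xpair_eqE !sidesE !andbF.
move=> [i k]; rewrite !inE unfold_in /= !xpair_eqE.
case: (i == j) => //=; by case: (sideP j k); rewrite !eqxx ?orbT.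
Qed.

Lemma angle_matchingP A :
  reflect (one_per_vertex A /\ forall j, ((j, entry_side j) \in A)
     + ((j, exit_side j) \in A) + ((j, third_side j) \in A) = 1) (angle_matching A).
Proof.
apply: (iffP andP) => -[h1 h2]; split.
- by move=> v; apply/eqP/(forallP h1).
- by move=> j; rewrite -card_triangle_angles; apply/eqP/(forallP h2).
- by apply/forallP => v; apply/eqP.
- by apply/forallP => j; rewrite card_triangle_angles; apply/eqP.
Qed.

Lemma good_angle_matchingsP A :
  reflect (coherent A) (A \in good_angle_matchings z).
Proof.
rewrite inE; apply: (iffP andP) => [[/angle_matchingP[A1 AS] nbad] | [AS AT]].
  have [u [uE uX uH]] := one_per_vertex_state A1.
  (* u i true + u i false is constant; A is bad when the constant is 0 or 2. *)
  split=> // j; rewrite uE uX ordSK.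
  (* If exactly one end of the diagonal is already matched, the two ends carry opposite states,
     which gives the required exclusive or. *)
  suff : u j true + u j false = 1.
    by case: (turn j); case: (turn _); case: (u j true); case: (u j false).
  (* Passing a triangle, one end of the diagonal changes by H and the other by E + X - 1; the total
     change vanishes because E + X + H = 1. *)
  have step i : u i true + u i false = u (ord_pred i) true + u (ord_pred i) false.
    move: (AS i) (uH i); rewrite uE uX; case: (turn i) => /=;
    by case: (u i true); case: (u i false); case: (u _ true); case: (u _ false);
      case: (_ \in _).
  have const i : u i true + u i false = u j true + u j false.
    have [m _ <-] := iter_ordS_onto j i; elim: m => //= m <-.
    by rewrite step ordSK.
  have all c : (forall i s, u i s = c) -> forall a, a \in A ->
      a.2 = if c then entry_side a.1 else exit_side a.1.
    move=> uc [i k]; case: (sideP i k); rewrite ?uE ?uX ?uc /=; case: (c) uc => //= uc.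
      by move: (uH i); rewrite !uc; case: (_ \in _).
    by move: (uH i); rewrite !uc; case: (_ \in _).
  have isbad c : (forall i s, u i s = c) -> bad A.
    move=> uc; apply/existsP.
    exists (ord0, exit_corner ord0 c); apply/existsP;
      exists (ord0, exit_corner ord0 (~~ c)).
    rewrite same_componentE !on_left_exit_corner; apply/andP; split; first by case: (c).
    apply/forall_inP => -[i k] /(all _ uc) /= ->.
    rewrite !same_componentE !on_left_exit_corner min_conditionE max_conditionE.
    by case: (c); rewrite on_leftE; case: (turn i); rewrite ?eqxx.
  have cc c : u j true + u j false = c.*2 -> c < 2 -> bad A.
    move=> uj c2; apply: (isbad (c == 1)) => i s; move: (const i); rewrite uj.
    by case: c c2 {uj} => [|[|]] //; case: s; case: (u i true); case: (u i false).
  case: (u j true) cc => cc; case: (u j false) cc => cc //.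
    by rewrite (cc 1) in nbad.
  by rewrite (cc 0) in nbad.
split.
  apply/angle_matchingP; split=> //.
  (* The state is forced: at the end [turn j] it must be the membership of the entry angle, and at
     the other end its negation, since the two states add up to 1. *)
  apply: (@vertex_state_one_per_vertex _ (fun j s =>
    (s == turn j) == ((j, entry_side j) \in A))).
  split=> j.
  - by rewrite eqxx; case: (_ \in _).
  - move: (AT (ord_pred j)); rewrite ord_predK.
    by case: (turn j); case: (turn _); case: (_ \in _); case: (_ \in _).
  - move: (AS j) (AT (ord_pred j)); rewrite ord_predK.
    by case: (turn j); case: (turn _); case: (_ \in _); case: (_ \in _); case: (_ \in _);
      case: (_ \in _).
apply/negP => /existsP[a /existsP[b /andP[]]].
rewrite same_componentE => ab /forall_inP minmax.
(* A bad coherent matching would consist of all the entry angles or all the exit angles. Then the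
   exclusive or is always true, so all turns agree, contradicting [turn_nonconst]. *)
suff const j : turn j = turn (ordS j).
  have [i ti] := turn_nonconst true; have [j tj] := turn_nonconst false.
  have [m _ mE] := iter_ordS_onto i j; move: tj; rewrite -mE.
  by elim: m {mE} => [|m IH] /=; rewrite ?ti // -const.
suff : turn j == turn (ordS j) by move=> /eqP.
rewrite -AT.
have cond i k : (i, k) \in A -> k = if on_left a then entry_side i else exit_side i.
  move=> /minmax; rewrite !same_componentE min_conditionE max_conditionE.
  move: ab; case: (on_left a); case: (on_left b) => // _;
  case: (sideP i k); rewrite on_leftE; case: (turn i); rewrite ?sidesE //=.
have third i : ((i, third_side i) \in A) = false.
  by apply/negP => /cond /eqP; case: ifP; rewrite sidesE.
move: (AS j) (AS (ordS j)); rewrite !third; case: (on_left a) cond => cond.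
  have noX i : ((i, exit_side i) \in A) = false by apply/negP => /cond /eqP; rewrite sidesE.
  by rewrite !noX; case: (_ \in _).
have noE i : ((i, entry_side i) \in A) = false by apply/negP => /cond /eqP; rewrite sidesE.
by rewrite !noE; case: (_ \in _); case: (_ \in _).
Qed.

End Loop.

(** * Snake and band graphs *)

Section Graphs.
Context (N : nat) (T : triangulation N) (z : essential_loop T).
Implicit Types (i j : 'I_(ncross z)) (h s : bool) (k : 'I_3).

(* The vertices of the snake graph: inl (i, s) is the end of the diagonal of
   tile i on the left (s = true) or right of the loop; inr false and inr true
   are the vertices v and v', which lie on no diagonal. *)
Definition snake_vertex : finType := ('I_(ncross z) * bool + bool)%type.
Implicit Types x : snake_vertex.

(** A corner off the diagonal of its tile lies on the diagonal of the adjacent tile containing the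
    same triangle. At the two ends of the snake there is no such tile, which leaves [v] and [v']. *)
Definition vertex_of (c : tile_corner z) : snake_vertex :=
  let: (i, h, k) := c in
  if k != diag_side i h then inl (i, on_left (half_tri i h, k))
  else if h then
    if i == ord_max then inr true else inl (ordS i, turn (ordS i))
  else if i == ord0 then inr false else inl (ord_pred i, turn i).

Definition corner_at x : tile_corner z :=
  match x with
  | inl (i, s) => (i, false, exit_corner i s)
  | inr false => vertex_v z
  | inr true => vertex_v' z
  end.

Lemma vertex_of_corner_at x : vertex_of (corner_at x) = x.
Proof.
case: x => [[i s]|[]] /=; rewrite ?exit_corner_neq ?on_left_exit_corner //.
  by rewrite ordS_max !eqxx.
by rewrite eqxx.
Qed.

Lemma snake_glue_vertex u v : @snake_glue N T z u v -> vertex_of u = vertex_of v.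
Proof.
case: u v => [[i h] c] [[i' h'] c'] /=.
case/or3P.
- case/and5P=> /eqP <- /negPf -> -> /= /eqP -> /eqP ->.
  by rewrite -(exit_cornerE i false) -(entry_cornerE (ordS i) false)
    exit_corner_neq entry_corner_neq on_left_exit_corner on_left_entry_corner.
- case/and5P=> /eqP <- /negPf -> -> /= /eqP -> /eqP ->.
  by rewrite -(exit_cornerE i true) -(entry_cornerE (ordS i) true)
    exit_corner_neq entry_corner_neq on_left_exit_corner on_left_entry_corner.
case/and5P=> /eqP ii' -> /negPf -> /= /eqP <- cN.
have im : i != ord_max.
  by apply: contraTneq (ltn_ord i') => im; rewrite ii' im /= ltnn.
have -> : i' = ordS i by apply: ord_inj; rewrite val_ordS.
rewrite eq_ordS0 (negPf im) ordSK.
have {cN} : c != third_side (ordS i).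
  by have <- : i' = ordS i by apply: ord_inj; rewrite val_ordS.
by case: (sideP (ordS i) c); rewrite ?eqxx // ?sidesE /= ?on_leftE.
Qed.

Lemma same_vertex_sym (G : tiled_graph z) : symmetric (same_vertex G).
Proof. by apply: sym_connect_sym => u v /=; rewrite orbC. Qed.

Lemma same_vertex_glue (G : tiled_graph z) u v :
  corner_glue G u v -> same_vertex G u v /\ same_vertex G v u.
Proof. by move=> uv; split; apply: connect1; rewrite /= uv ?orbT. Qed.

Lemma snake_corner_at u : same_vertex (snake z) u (corner_at (vertex_of u)).
Proof.
have diag i s : same_vertex (snake z) (i, true, entry_corner (ordS i) s) (i, false,
  exit_corner i s).
  have /same_vertex_glue[] //
    : corner_glue (snake z) (i, false, exit_corner i s) (i, true, entry_corner (ordS i) s).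
  by rewrite /= eqxx exit_cornerE entry_cornerE; case: s; rewrite !eqxx ?orbT.
have third i k : i != ord_max -> k != third_side (ordS i) ->
   corner_glue (snake z) (i, true, k) (ordS i, false, k).
  by move=> im kN /=; have /= -> := val_ordS im; rewrite !eqxx kN !orbT.
case: u => [[i h] c] /=; case: ifP => [cN | /negbFE/eqP ->].
  case: h cN => /= cN.
    by rewrite -{1}(entry_cornerK cN).
  by rewrite exit_cornerK //; apply: connect0.
case: h => /=.
  case: eqP => [-> | /eqP im]; first by rewrite /= /vertex_v' ordS_max; apply: connect0.
  rewrite /corner_at /exit_corner eqxx;
    have [] // := same_vertex_glue (third i (entry_side (ordS i)) im _).
  by rewrite sidesE.
case: eqP => [-> | /eqP i0]; first exact: connect0.
have pm : ord_pred i != ord_max by rewrite eq_ord_pred_max.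
have := third _ (exit_side i) pm;
  rewrite ord_predK sidesE => /(_ isT)/same_vertex_glue[_ h].
apply: connect_trans h _; have := diag (ord_pred i) (turn i).
by rewrite ord_predK /entry_corner eqxx.
Qed.

Lemma snake_same_vertex u v :
  same_vertex (snake z) u v = (vertex_of u == vertex_of v).
Proof.
apply/idP/eqP => [/connectP[p] | uv].
  elim: p u => [|c p IH] u /=; first by move=> _ ->.
  by move=> /andP[h /IH{}IH] /IH <-; case/orP: h => /snake_glue_vertex ->.
apply: connect_trans (snake_corner_at u) _.
by rewrite uv -/(same_vertex _ _ _) same_vertex_sym snake_corner_at.
Qed.

Notation first_third i := (widen_ord (leqnSn (ncross z)) i).
Notation second_third i := (lift (@ord0 (ncross z)) i).

(** For a vertex on a diagonal, each half of the tile contributes one block. If the corner in that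
    half is an end of the third side, the block also contains an edge of the neighbouring tile,
    where the shared triangle has another side as diagonal; this edge is absent at the ends of the
    snake. *)
Definition edges_at x : seq (edge (snake z)) :=
  match x with
  | inl (i, s) =>
    (if s == turn i then
       inr (first_third i) :: (if i == ord0 then [::] else [:: inl (ord_pred i, true)])
     else [:: inl (i, false)])
    ++ (if s == turn (ordS i) then
          inr (second_third i) :: (if i == ord_max then [::] else [:: inl (ordS i, false)])
        else [:: inl (i, true)])
  | inr false => [:: inr ord0; inl (ord0, false)]
  | inr true => [:: inr ord_max; inl (ord_max, true)]
  end.

Lemma first_third0 : first_third ord0 = ord0.
Proof. exact: val_inj. Qed.

Lemma second_third_max : second_third ord_max = ord_max.
Proof. exact: val_inj. Qed.

Lemma second_third_pred i : i != ord0 -> second_third (ord_pred i) = first_third i.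
Proof.
move=> i0; apply: val_inj; rewrite /= /bump leq0n add1n.
by rewrite -{2}[i]ord_predK val_ordS // eq_ord_pred_max.
Qed.

Lemma eq_negb b : (~~ b == b) = false.
Proof. by case: b. Qed.

Lemma mem_edges_at i h k (c : 'I_3) : k != diag_side i h -> c != k ->
  tile_edge (snake z) i h k \in edges_at (vertex_of (i, h, c)).
Proof.
rewrite /tile_edge /vertex_of; case: h => /=.
  case: (sideP (ordS i) k); case: (sideP (ordS i) c);
    rewrite ?eqxx // ?sidesE ?on_leftE /= => _ _.
  - have [-> | im] := eqVneq i ord_max; first by rewrite !inE eqxx orbT.
    rewrite /= mem_cat; apply/orP; left.
    by rewrite eqxx eq_ordS0 (negPf im) ordSK !inE eqxx orbT.
  - by rewrite mem_cat eq_negb mem_head orbT.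
  - have [-> | im] := eqVneq i ord_max; first by rewrite second_third_max mem_head.
    rewrite /= mem_cat; apply/orP; left.
    by rewrite eqxx -second_third_pred ?eq_ordS0 // ordSK mem_head.
  - by rewrite mem_cat eqxx mem_head orbT.
case: (sideP i k); case: (sideP i c); rewrite ?eqxx // ?sidesE ?on_leftE /= => _ _.
- have [-> | i0] := eqVneq i ord0; first by rewrite !inE eqxx orbT.
  rewrite /= mem_cat; apply/orP; right.
  by rewrite ord_predK eqxx eq_ord_pred_max (negPf i0) !inE eqxx orbT.
- by rewrite mem_cat eq_negb mem_head.
- by rewrite mem_cat eqxx mem_head.
- have [-> | i0] := eqVneq i ord0; first by rewrite first_third0 mem_head.
  rewrite /= mem_cat; apply/orP; right.
  by rewrite ord_predK eqxx second_third_pred // mem_head.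
Qed.

Lemma edges_at_tile_edge x (e : edge (snake z)) : e \in edges_at x ->
  exists i h k c, [/\ k != diag_side i h, c != k, tile_edge (snake z) i h k = e
                    & vertex_of (i, h, c) = x].
Proof.
case: x => [[i s]|[]]; last 2 first.
- rewrite !inE => /orP[] /eqP ->.
    exists ord_max, true, (third_side (@ord0 (len z))), (entry_side (@ord0 (len z))).
    by rewrite /tile_edge /= ordS_max !sidesE !eqxx /= second_third_max.
  exists ord_max, true, (exit_side (@ord0 (len z))), (entry_side (@ord0 (len z))).
  by rewrite /tile_edge /= ordS_max !sidesE !eqxx.
- rewrite !inE => /orP[] /eqP ->.
    exists ord0, false, (third_side (@ord0 (len z))), (exit_side (@ord0 (len z))).
    by rewrite /tile_edge /= !sidesE !eqxx /= first_third0.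
  exists ord0, false, (entry_side (@ord0 (len z))), (exit_side (@ord0 (len z))).
  by rewrite /tile_edge /= !sidesE !eqxx.
rewrite mem_cat => /orP[]; case: (eqVneq s) => [-> | sN].
- rewrite inE => /orP[/eqP -> | ].
    exists i, false, (third_side i), (entry_side i).
    by rewrite /tile_edge /= !sidesE !eqxx /= on_leftE.
  case: (eqVneq i ord0) => // i0; rewrite inE => /eqP ->.
  exists (ord_pred i), true, (exit_side i), (entry_side i).
  by rewrite /tile_edge /= ord_predK !sidesE !eqxx /= eq_ord_pred_max (negPf i0).
- rewrite inE => /eqP ->; exists i, false, (entry_side i), (third_side i).
  rewrite /tile_edge /= !sidesE on_leftE; split=> //; congr (inl (_, _)).
  by case: s (turn i) sN => -[].
- rewrite inE => /orP[/eqP -> | ].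
    exists i, true, (third_side (ordS i)), (exit_side (ordS i)).
    by rewrite /tile_edge /= !sidesE !eqxx /= on_leftE.
  case: (eqVneq i ord_max) => // im; rewrite inE => /eqP ->.
  exists (ordS i), false, (entry_side (ordS i)), (exit_side (ordS i)).
  by rewrite /tile_edge /= !sidesE !eqxx /= eq_ordS0 ordSK (negPf im).
- rewrite inE => /eqP ->; exists i, true, (exit_side (ordS i)), (third_side (ordS i)).
  rewrite /tile_edge /= !sidesE on_leftE; split=> //; congr (inl (_, _)).
  by case: s (turn _) sN => -[].
Qed.

Lemma snake_incident (e : edge (snake z)) v :
  incident e v = (e \in edges_at (vertex_of v)).
Proof.
apply/idP/idP => [|/edges_at_tile_edge[i [h [k [c [kN cN <- cv]]]]]].
  case/existsP=> i /existsP[h /existsP[k /existsP[c /and4P[kN /eqP <- cN]]]].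
  by rewrite snake_same_vertex => /eqP <-; apply: mem_edges_at.
apply/existsP; exists i; apply/existsP; exists h; apply/existsP; exists k.
by apply/existsP; exists c; rewrite kN cN eqxx snake_same_vertex cv eqxx.
Qed.

(** With a single crossing there would be a single turn, against [turn_nonconst]. *)
Lemma ncross_neq1 : @ord0 (len z) != ord_max.
Proof.
apply/eqP => zm; have [i ti] := turn_nonconst z true; have [j tj] := turn_nonconst z false.
have all0 (l : 'I_(ncross z)) : l = ord0.
  have z0 : 0 = len z := congr1 val zm.
  by apply: ord_inj; apply/eqP; rewrite -leqn0 [X in _ <= X]z0 leq_ord.
by move: ti; rewrite (all0 i) -(all0 j) tj.
Qed.

Lemma ordS_neq i : (ordS i == i) = false.
Proof.
apply/negP => /eqP h.
have all j : j = i by have [m _ <-] := iter_ordS_onto i j; elim: m => //= m ->.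
by have := ncross_neq1; rewrite (all ord0) (all ord_max) eqxx.
Qed.

Lemma ord_pred_neq i : (ord_pred i == i) = false.
Proof. by rewrite eq_ord_pred eq_sym ordS_neq. Qed.

(** The hypothesis leaves only two triangles, and the turns are not constant. *)
Lemma ordS0_max : ordS (@ord0 (len z)) = ord_max ->
  turn (@ord0 (len z)) != turn (@ord_max (len z)).
Proof.
move=> h; have all j : j = ord0 \/ j = ord_max.
  have [m _ <-] := iter_ordS_onto (@ord0 (len z)) j.
  elim: m => [|m IH] /=; first by left.
  by case: IH => ->; [right | left; rewrite ordS_max].
have [i ti] := turn_nonconst z true; have [j tj] := turn_nonconst z false.
by case: (all i) (all j) ti tj => -> [] -> -> // ->.
Qed.

Lemma uniq_edges_at x : uniq (edges_at x).
Proof.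
  have thirdN i : (first_third i == second_third i) = false.
    by apply/negbTE; rewrite neq_ltn /= /bump leq0n add1n leqnn.
  case: x => [[i s]|[]] //.
  rewrite /edges_at; do ! case: ifP => _.
  all: rewrite /= ?inE ?sum_eqE ?xpair_eqE.
  all: by rewrite ?thirdN ?ord_pred_neq ?[_ == ordS _]eq_sym ?ordS_neq ?andbF.
Qed.

Lemma snake_perfectE (Q : {set edge (snake z)}) :
  perfect_matching Q <-> forall x, count (mem Q) (edges_at x) = 1.
Proof.
split=> [/forallP Q1 x|Q1].
  have /eqP <- := Q1 (corner_at x).
  rewrite (card_setI_seq _ (uniq_edges_at x)) // => e.
  by rewrite unfold_in snake_incident vertex_of_corner_at.
apply/forallP => v; apply/eqP.
rewrite (card_setI_seq _ (uniq_edges_at (vertex_of v))) // => e.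
by rewrite unfold_in snake_incident.
Qed.

(** * Vertices and edges of the band graph *)

(** Normal form for the vertices of the band graph: [v'] is replaced by [v], and [w'], which is the
    end [turn ord0] of the last diagonal, by [w], the same end of the first diagonal. *)
Definition glue_vertex x : snake_vertex :=
  if x == inr true then inr false
  else if x == inl (ord_max, turn (@ord0 (len z))) then inl (ord0, turn (@ord0 (len z)))
  else x.

Lemma vertex_of_v : vertex_of (vertex_v z) = inr false.
Proof. exact: (vertex_of_corner_at (inr false)). Qed.

Lemma vertex_of_v' : vertex_of (vertex_v' z) = inr true.
Proof. exact: (vertex_of_corner_at (inr true)). Qed.

Lemma vertex_of_w : vertex_of (vertex_w z) = inl (ord0, turn (@ord0 (len z))).
Proof. by rewrite /vertex_of /vertex_w /= sidesE on_leftE. Qed.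

Lemma vertex_of_w' : vertex_of (vertex_w' z) = inl (ord_max, turn (@ord0 (len z))).
Proof. by rewrite /vertex_of /vertex_w' /= ordS_max sidesE on_leftE. Qed.

Lemma snake_band_same_vertex u v :
  same_vertex (snake z) u v -> same_vertex (band z) u v.
Proof.
apply: connect_sub => a b /=.
by case/orP => h; apply: connect1; rewrite /= /band_glue h ?orbT.
Qed.

Lemma band_same_vertex u v :
  same_vertex (band z) u v =
  (glue_vertex (vertex_of u) == glue_vertex (vertex_of v)).
Proof.
have vv' : corner_glue (band z) (vertex_v z) (vertex_v' z).
  by rewrite /= /band_glue !eqxx orbT.
have ww' : corner_glue (band z) (vertex_w z) (vertex_w' z).
  by rewrite /= /band_glue !eqxx !orbT.
apply/idP/eqP => [/connectP[p] | uv].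
  elim: p u => [|c p IH] u /=; first by move=> _ ->.
  move=> /andP[h /IH{}IH] /IH <-.
  have step a b : band_glue a b -> glue_vertex (vertex_of a) = glue_vertex (vertex_of b).
    case/or3P=> [/snake_glue_vertex -> // | /andP[/eqP -> /eqP ->] | /andP[/eqP -> /eqP
      ->]].
      by rewrite vertex_of_v vertex_of_v'.
    rewrite vertex_of_w vertex_of_w' /glue_vertex /= eqxx.
    by case: ifP => // /eqP [] /eqP; rewrite (negPf ncross_neq1).
  by case/orP: h => /step.
have rep a : same_vertex (band z) a (corner_at (glue_vertex (vertex_of a))).
  rewrite /glue_vertex; case: eqP => [av|_].
    apply: connect_trans (proj2 (same_vertex_glue vv')).
    by apply: snake_band_same_vertex; rewrite snake_same_vertex av vertex_of_v'.
  case: eqP => [aw|_]; last exact/snake_band_same_vertex/snake_corner_at.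
  have h : same_vertex (band z) a (vertex_w' z).
    by apply: snake_band_same_vertex; rewrite snake_same_vertex aw vertex_of_w'.
  apply: connect_trans h (connect_trans (proj2 (same_vertex_glue ww')) _).
  by apply: snake_band_same_vertex;
    rewrite snake_same_vertex vertex_of_w vertex_of_corner_at.
apply: connect_trans (rep u) _.
by rewrite uv -/(same_vertex _ _ _) same_vertex_sym rep.
Qed.

Lemma inZp_first_third i : inZp (first_third i) = i :> 'I_(ncross z).
Proof. by apply: ord_inj; rewrite /= modn_small. Qed.

Lemma inZp_second_third i : inZp (second_third i) = ordS i :> 'I_(ncross z).
Proof. exact: ord_inj. Qed.

Lemma tile_edge_band i h k :
  tile_edge (band z) i h k = snake_to_band (tile_edge (snake z) i h k).
Proof.
rewrite /tile_edge; case: ifP => // _ /=.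
by case: h; rewrite ?inZp_first_third ?inZp_second_third.
Qed.

Lemma band_incident (e : edge (band z)) v :
  incident e v <-> exists x, glue_vertex x = glue_vertex (vertex_of v) /\
    e \in [seq snake_to_band e' | e' <- edges_at x].
Proof.
split=> [|[x [xv /mapP[e' /edges_at_tile_edge[i [h [k [c [kN cN <- cv]]]]] ->]]]].
  case/existsP=> i /existsP[h /existsP[k /existsP[c /and4P[kN /eqP <- cN]]]].
  rewrite band_same_vertex => /eqP ev; exists (vertex_of (i, h, c)); split=> //.
  by rewrite tile_edge_band map_f // mem_edges_at.
apply/existsP; exists i; apply/existsP; exists h; apply/existsP; exists k.
apply/existsP; exists c; rewrite kN cN tile_edge_band eqxx band_same_vertex cv.
by rewrite xv eqxx.
Qed.

(** * Good matchings of the band graph *)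

(** The analogue of [coherent]: the edges [inl (i, false)], [inl (ord_pred i, true)] and [inr i] are
    the entry, exit and third sides of Delta_i. *)
Definition matching_coherent (P : {set edge (band z)}) : Prop :=
  (forall i, (inr i \in P) + (inl (i, false) \in P)
             + (inl (ord_pred i, true) \in P) = 1) /\
  (forall i, (inl (i, false) \in P) (+) (inl (i, true) \in P)
             = (turn i == turn (ordS i))).

(* The edges at v or w, other than tau, on the first and last side of the cut. *)
Definition first_edges : seq (edge (band z)) :=
  inl (ord0, false) ::
  if turn (@ord0 (len z)) == turn (ordS (@ord0 (len z)))
  then [:: inr (ordS ord0); inl (ordS ord0, false)] else [:: inl (ord0, true)].

Definition last_edges : seq (edge (band z)) :=
  inl (ord_max, true) ::
  if turn (@ord0 (len z)) == turn (@ord_max (len z))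
  then [:: inr ord_max; inl (ord_pred ord_max, true)] else [:: inl (ord_max, false)].

(** The delicate case is that of two crossings, where Delta_1 is adjacent to the cut on both sides.
    Both lists would use its third side if the turns agreed, which [ordS0_max] forbids. *)
Lemma uniq_first_last : uniq (tau_band z :: first_edges ++ last_edges).
Proof.
have m0 := negbTE ncross_neq1.
have S0 : turn (@ord0 (len z))
  = turn (@ord_max (len z)) -> (ordS (@ord0 (len z)) == ord_max) = false.
  by move=> t; apply/negP => /eqP/ordS0_max; rewrite t eqxx.
have S1 : turn (@ord0 (len z))
  = turn (ordS (@ord0 (len z))) -> (ordS (@ord0 (len z)) == ord_max) = false.
  by move=> t; apply/negP => /eqP h; move: (ordS0_max h); rewrite t h eqxx.
rewrite /first_edges /last_edges /tau_band.
case: (eqVneq (turn ord0)) => [/S1 h1|_]; case: (eqVneq (turn ord0)) => [/S0 h2|_] /=;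
  rewrite ?inE ?sum_eqE ?xpair_eqE ?[ord0 == ordS _]eq_sym
    ?[ord0 == ord_pred _]eq_sym ?[ord_max == ord_pred _]eq_sym ?ordS_neq ?ord_pred_neq
    ?eq_ord_pred ?[ord_max == ordS ord0]eq_sym ?m0 ?h1 ?h2 ?andbF //=.
Qed.

Notation band_edges_at x := [seq snake_to_band e' | e' <- edges_at x].

Lemma snake_to_band_inl a : snake_to_band (inl a : edge (snake z)) = inl a.
Proof. by []. Qed.

Lemma snake_to_band_first i :
  snake_to_band (inr (first_third i) : edge (snake z)) = inr i.
Proof. by rewrite /= inZp_first_third. Qed.

Lemma snake_to_band_second i :
  snake_to_band (inr (second_third i) : edge (snake z)) = inr (ordS i).
Proof. by rewrite /= inZp_second_third. Qed.

Definition snake_to_bandE :=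
  (snake_to_band_inl, snake_to_band_first, snake_to_band_second).
#[local] Arguments snake_to_band : simpl never.

Lemma band_edges_v : band_edges_at (inr false) = [:: tau_band z; inl (ord0, false)].
Proof. by congr [:: inr _; _]; apply: ord_inj. Qed.

Lemma band_edges_v' : band_edges_at (inr true) = [:: tau_band z; inl (ord_max, true)].
Proof. by congr [:: inr _; _]; apply: ord_inj; rewrite /= modnn. Qed.

Lemma band_edges_w : band_edges_at (inl (ord0, turn (@ord0 (len z))))
  = tau_band z :: behead first_edges.
Proof.
rewrite /= !eqxx (negPf ncross_neq1) /= snake_to_bandE /first_edges /tau_band.
by case: ifP => _; rewrite /= ?snake_to_bandE.
Qed.

Lemma band_edges_w' : band_edges_at (inl (ord_max, turn (@ord0 (len z))))
  = rcons (behead last_edges) (tau_band z).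
Proof.
rewrite /= ordS_max eqxx [ord_max == ord0]eq_sym (negPf ncross_neq1) /= eqxx map_cat /=
  snake_to_bandE ordS_max.
rewrite cats1 /last_edges /=; congr rcons.
by case: ifP => _; rewrite /= ?snake_to_bandE.
Qed.

Lemma glue_vertex_v x : glue_vertex x = glue_vertex (inr false) ->
  x = inr false \/ x = inr true.
Proof.
rewrite /glue_vertex /=; case: x => [p|[]]; [|by right|by left].
by rewrite /=; case: ifP.
Qed.

Lemma glue_vertex_w x : glue_vertex x = glue_vertex (inl (ord0, turn (@ord0 (len z)))) ->
  x = inl (ord0, turn (@ord0 (len z))) \/ x = inl (ord_max, turn (@ord0 (len z))).
Proof.
rewrite /glue_vertex /=;
  have -> : (inl (ord0, turn (@ord0 (len z))) == inl (ord_max, turn (@ord0 (len z))) :>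
  snake_vertex) = false.
  by apply: contraNF ncross_neq1 => /eqP [h]; apply/eqP/ord_inj.
case: x => [p|[]] //=; case: eqP => [-> | _]; [by right | by left].
Qed.

Lemma vertex_v_edges e : incident e (vertex_v z) =
  (e \in [:: tau_band z; inl (ord0, false); inl (ord_max, true)]).
Proof.
apply/idP/idP => [/band_incident[x []]|].
  rewrite vertex_of_v => /glue_vertex_v[] ->;
    rewrite ?band_edges_v ?band_edges_v' !inE => /orP[] ->;
  by rewrite ?orbT.
move=> eI; apply/band_incident; rewrite vertex_of_v.
have [e1|e1] := boolP (e \in band_edges_at (inr false)); first by exists (inr false).
exists (inr true); split=> //; move: eI e1; rewrite band_edges_v band_edges_v' !inE.
by case: (e == tau_band z); case: (e == _).
Qed.

Lemma vertex_w_edges e : incident e (vertex_w z) =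
  (e \in tau_band z :: behead first_edges ++ behead last_edges).
Proof.
rewrite in_cons mem_cat; apply/idP/idP => [/band_incident[x []]|].
  rewrite vertex_of_w => /glue_vertex_w[] ->;
    rewrite ?band_edges_w ?band_edges_w' ?mem_rcons in_cons => /orP[] ->;
  by rewrite ?orbT.
move=> eI; apply/band_incident; rewrite vertex_of_w.
have [e1|e1] := boolP (e \in band_edges_at (inl (ord0, turn (@ord0 (len z))))).
  by exists (inl (ord0, turn (@ord0 (len z)))).
exists (inl (ord_max, turn (@ord0 (len z)))); split;
  first by rewrite /glue_vertex /= eqxx; case: ifP.
move: eI e1; rewrite band_edges_w band_edges_w' mem_rcons !in_cons.
by case: (e == tau_band z); case: (e \in behead first_edges).
Qed.

(** Reduction modulo n identifies only 0 and n among the indices 0, ..., n, so [tau_band] is the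
    only edge with two lifts. *)
Lemma snake_to_band_inj (e e' : edge (snake z)) :
  snake_to_band e != tau_band z -> snake_to_band e = snake_to_band e' -> e = e'.
Proof.
have val0 (j : 'I_(ncross z).+1) : inr (inZp j) != tau_band z -> val (inZp j
  : 'I_(ncross z)) = val j.
  move=> jN; suff jn : j < ncross z by rewrite /= modn_small.
  rewrite ltn_neqAle -ltnS ltn_ord andbT; apply: contraNneq jN => h.
  by apply/eqP; congr inr; apply: ord_inj; rewrite /= h modnn.
rewrite /snake_to_band; case: e e' => [a|j] [a'|j'] //=; first by move=> _ [->].
move=> jN jj; have jN' := jN; rewrite jj in jN'.
by congr inr; apply: ord_inj; rewrite -(val0 _ jN) -(val0 _ jN'); case: jj => jj;
  rewrite /= jj.
Qed.

Lemma snake_to_band_surj (e : edge (band z)) : exists e', snake_to_band e' = e.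
Proof.
case: e => [a|i]; first by exists (inl a).
by exists (inr (first_third i)); rewrite snake_to_bandE.
Qed.

Lemma mem_band_edges_at x (e : edge (snake z)) : snake_to_band e != tau_band z ->
  (snake_to_band e \in band_edges_at x) = (e \in edges_at x).
Proof.
move=> eN; apply/mapP/idP => [[e' e'x /(snake_to_band_inj eN) -> //] | ex].
by exists e.
Qed.

Lemma uniq_band_edges_at i s : uniq (band_edges_at (inl (i, s))).
Proof.
rewrite /edges_at; do ! case: ifP => _.
all: rewrite /= ?snake_to_bandE ?inE ?sum_eqE ?xpair_eqE.
all: by rewrite ?ord_pred_neq ?[_ == ordS _]eq_sym ?ordS_neq ?andbF.
Qed.

(** The first two equations are those of [v] and [w], which collect the edges of both sides of the
    cut with tau counted once. At the other vertices the end cases of [edges_at] do not occur, so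
    the snake equations have a uniform shape. *)
Lemma band_perfectE (P : {set edge (band z)}) : perfect_matching P <->
  [/\ (tau_band z \in P) + (inl (ord0, false) \in P) + (inl (ord_max, true) \in P) = 1,
      (tau_band z \in P) + count (mem P) (behead first_edges)
        + count (mem P) (behead last_edges) = 1
    & forall i s, (i, s) != (ord0, turn (@ord0 (len z))) ->
        (i, s) != (ord_max, turn (@ord0 (len z))) ->
        (if s == turn i then (inr i \in P) + (inl (ord_pred i, true) \in P)
         else (inl (i, false) \in P) : nat)
        + (if s == turn (ordS i) then (inr (ordS i) \in P) + (inl (ordS i, false) \in P)
           else (inl (i, true) \in P) : nat) = 1].
Proof.
have cardv : #|[set e in P | incident e (vertex_v z)]| =
    (tau_band z \in P) + (inl (ord0, false) \in P) + (inl (ord_max, true) \in P).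
  rewrite (@card_setI_seq _ _ _ ([:: tau_band z; inl (ord0, false);
    inl (ord_max, true)])) /=.
  - by rewrite addn0 addnA.
  - by rewrite !inE /= andbT; apply/eqP => -[].
  by move=> e; rewrite unfold_in vertex_v_edges.
have cardw : #|[set e in P | incident e (vertex_w z)]| =
    (tau_band z \in P) + count (mem P) (behead first_edges)
        + count (mem P) (behead last_edges).
  rewrite (@card_setI_seq _ _ _ (tau_band z :: behead first_edges ++ behead last_edges)) /=.
  - by rewrite count_cat addnA.
  - have sub : subseq (tau_band z :: behead first_edges ++ behead last_edges)
                 (tau_band z :: first_edges ++ last_edges).
      apply: (@cat_subseq _ [:: tau_band z] _ [:: tau_band z]) => //.
      by apply: cat_subseq; apply: subseq_cons.
    exact: subseq_uniq sub uniq_first_last.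
  by move=> e; rewrite unfold_in vertex_w_edges.
have cardi i s v : vertex_of v = inl (i, s) ->
    (i, s) != (ord0, turn (@ord0 (len z))) ->
    (i, s) != (ord_max, turn (@ord0 (len z))) ->
    #|[set e in P | incident e v]| = count (mem P) (band_edges_at (inl (i, s))).
  move=> vE n0 nm; rewrite (card_setI_seq _ (uniq_band_edges_at i s)) // => e.
  rewrite unfold_in; apply/idP/idP => [/band_incident[x []]|eI]; last first.
    by apply/band_incident; exists (inl (i, s)); rewrite vE.
  rewrite vE {2}/glue_vertex /=.
  rewrite eq_inl (negPf nm) /glue_vertex; case: eqP => // _; case: eqP => [_ h | _ -> //].
  by move: n0; rewrite -(eq_inl bool) h eqxx.
have counti i s : (i, s) != (ord0, turn (@ord0 (len z))) ->
    (i, s) != (ord_max, turn (@ord0 (len z))) -> count (mem P) (band_edges_at (inl (i,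
      s))) =
    (if s == turn i then (inr i \in P) + (inl (ord_pred i, true) \in P)
         else (inl (i, false) \in P) : nat)
        + (if s == turn (ordS i) then (inr (ordS i) \in P) + (inl (ordS i, false) \in P)
           else (inl (i, true) \in P) : nat).
  rewrite !xpair_eqE => n0 nm; rewrite /edges_at map_cat count_cat; congr (_ + _).
    case: (eqVneq s (turn i)) n0 nm => [-> | _] n0 nm; last by rewrite /= addn0.
    have i0 : i != ord0 by apply: contraNneq n0 => ->; rewrite !eqxx.
    by rewrite (negPf i0) /= !snake_to_bandE addn0.
  case: (eqVneq s (turn (ordS i))) n0 nm => [-> | _] n0 nm; last by rewrite /= addn0.
  have im : i != ord_max by apply: contraNneq nm => ->; rewrite ordS_max !eqxx.
  by rewrite (negPf im) /= !snake_to_bandE addn0.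
split=> [/forallP P1 | [Pv Pw Pi]].
  split; [by rewrite -cardv; apply/eqP | by rewrite -cardw; apply/eqP |].
  move=> i s n0 nm; rewrite -counti // -(cardi i s (corner_at (inl (i, s)))) //;
    first exact/eqP.
  exact: vertex_of_corner_at.
apply/forallP => v; apply/eqP.
have same v' : glue_vertex (vertex_of v) = glue_vertex (vertex_of v') ->
    #|[set e in P | incident e v]| = #|[set e in P | incident e v']|.
  move=> vv'; apply: eq_card => e; rewrite !inE; congr (_ && _).
  apply/idP/idP => /band_incident[x [xv ex]]; apply/band_incident; exists x.
    by rewrite -vv'.
  by rewrite vv'.
case vE : (vertex_of v) => [[i s]|b].
  have [[i0 s0] | n0] := eqVneq (i, s) (ord0, turn (@ord0 (len z))).
    by rewrite (same (vertex_w z)) ?cardw // vE vertex_of_w i0 s0.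
  have [[im sm] | nm] := eqVneq (i, s) (ord_max, turn (@ord0 (len z))).
    rewrite (same (vertex_w z)) ?cardw // vE vertex_of_w im sm.
    by rewrite /glue_vertex /= eqxx; case: ifP.
  by rewrite (cardi i s) // counti // Pi.
by rewrite (same (vertex_v z)) ?cardv // vE vertex_of_v; case: (b).
Qed.

Lemma all_not_mem (U : finType) (P : {set U}) (s : seq U) :
  (count (mem P) s == 0) = [forall e in P, e \notin s].
Proof.
rewrite -leqn0 leqNgt -has_count; apply/hasPn/forall_inP => h e.
  by move=> eP; apply/negP => /h /=; rewrite eP.
by move=> es; apply/negP => /= /h; rewrite es.
Qed.

Lemma incident_vw (P : {set edge (band z)}) e : tau_band z \notin P -> e \in cut P ->
  [/\ snake_to_band e != tau_band z,
      incident (snake_to_band e) (vertex_v z) || incident (snake_to_band e) (vertex_w z)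
      = (snake_to_band e \in first_edges) || (snake_to_band e \in last_edges),
      incident e (vertex_v z) || incident e (vertex_w z) = (snake_to_band e \in first_edges)
    & incident e (vertex_v' z) || incident e (vertex_w' z)
      = (snake_to_band e \in last_edges)].
Proof.
move=> tauP; rewrite inE => eP.
have eN : snake_to_band e != tau_band z by apply: contraNneq tauP => <-.
rewrite vertex_v_edges vertex_w_edges !snake_incident vertex_of_v vertex_of_w
  vertex_of_v' vertex_of_w' -!mem_band_edges_at //.
have memF : (snake_to_band e \in first_edges) =
    (snake_to_band e == inl (ord0, false)) || (snake_to_band e \in behead first_edges) by
      [].
have memL : (snake_to_band e \in last_edges) =
    (snake_to_band e == inl (ord_max, true)) || (snake_to_band e \in behead last_edges)
      by [].
have memT (r : seq (edge (band z))) : (snake_to_band e \in tau_band z :: r)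
  = (snake_to_band e \in r).
  by rewrite in_cons (negPf eN).
rewrite band_edges_v band_edges_v' band_edges_w band_edges_w' mem_rcons.
rewrite !memT memF memL mem_cat !inE; split=> //.
by do 2! case: (_ == _) => //=; rewrite ?orbT.
Qed.

(** Without tau, the edges of [P] at [v] or [w] split between two disjoint lists; all lie on the
    first side when none is in the second list. *)
Lemma first_sideE (P : {set edge (band z)}) : tau_band z \notin P ->
  first_side P = (count (mem P) last_edges == 0).
Proof.
move=> tauP; rewrite all_not_mem; apply/forall_inP/forall_inP => h e eP.
  have [e' e'E] := snake_to_band_surj e; have e'P : e' \in cut P by rewrite inE e'E.
  have [eN h1 h2 _] := incident_vw tauP e'P.
  have := h e' e'P; rewrite h1 h2 e'E; apply: contraL => eL; rewrite eL orbT /=.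
  have := uniq_first_last;
    rewrite cons_uniq cat_uniq => /and4P[_ _ /hasPn /(_ _ eL) /= eF _].
  exact: eF.
have [eN h1 h2 _] := incident_vw tauP eP; rewrite h1 h2.
rewrite inE in eP; rewrite (negPf (h _ eP)) orbF; exact: implybb.
Qed.

Lemma last_sideE (P : {set edge (band z)}) : tau_band z \notin P ->
  last_side P = (count (mem P) first_edges == 0).
Proof.
move=> tauP; rewrite all_not_mem; apply/forall_inP/forall_inP => h e eP.
  have [e' e'E] := snake_to_band_surj e; have e'P : e' \in cut P by rewrite inE e'E.
  have [eN h1 _ h2] := incident_vw tauP e'P.
  have := h e' e'P; rewrite h1 h2 e'E; apply: contraL => eF; rewrite eF /=.
  have := uniq_first_last; rewrite cons_uniq cat_uniq => /and4P[_ _ /hasPn eL _].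
  by apply/negP => /eL /=; rewrite eF.
have [eN h1 _ h2] := incident_vw tauP eP; rewrite h1 h2.
rewrite inE in eP; rewrite (negPf (h _ eP)); exact: implybb.
Qed.

(* The equation at the end s of the diagonal of a tile, t and t' being the turns
   in its two halves: given one edge in each half, it does not depend on s. *)
Lemma vertex_count (e x h h' e' x' t t' s : bool) :
  h + e + x' = 1 -> h' + e' + x = 1 ->
  ((if s == t then h + x' else e) + (if s == t' then h' + e' else x) = 1)
    <-> e (+) x = (t == t').
Proof.
by case: e x h h' e' x' t t' s => [] [] [] [] [] [] [] [] [].
Qed.

(** Coherence makes [v] and [w] be covered from the same side. If the first two turns agree, the
    count is H_1 + E_1 = 1 - X_1 = E_0; otherwise it is X_1 = E_0. *)
Lemma count_first_edges (P : {set edge (band z)}) : matching_coherent P ->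
  count (mem P) (behead first_edges) = (inl (ord0, false) \in P).
Proof.
move=> [PS PT]; move: (PT ord0) (PS (ordS ord0)); rewrite ordSK /first_edges.
case: (_ == _) => /=; last by case: (_ \in P); case: (_ \in P).
by case: (_ \in P); case: (_ \in P); case: (_ \in P) => //; case: (_ \in P).
Qed.

Lemma good_matchingsP (P : {set edge (band z)}) :
  reflect (matching_coherent P) (P \in good_matchings z).
Proof.
have predS i : ord_pred (ordS i) = i by rewrite ordSK.
rewrite inE; apply: (iffP andP) => [[/band_perfectE[Pv Pw Pi] good] | [PS PT]].
  (* Adding the equations at both ends of a diagonal away from the cut counts every edge of its two
     triangles once. *)
  have sum i : i != ord0 -> i != ord_max ->
      ((inr i \in P) + (inl (i, false) \in P) + (inl (ord_pred i, true) \in P)) +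
      ((inr (ordS i) \in P) + (inl (ordS i, false) \in P) + (inl (i, true) \in P)) = 2.
    move=> i0 im; have h s
      : (i, s) != (ord0, turn (@ord0 (len z))) /\ (i, s) != (ord_max, turn (@ord0 (len z))).
      by rewrite !xpair_eqE (negPf i0) (negPf im).
    have [h1 h2] := h true; have [h3 h4] := h false.
    move: (Pi i true h1 h2) (Pi i false h3 h4).
    case: (turn i); case: (turn _) => /=;
      move: (_ \in P) (_ \in P) (_ \in P) (_ \in P) (_ \in P) (_ \in P);
    by do 6! case.
  (* Goodness enters here. It makes the edges on the first side at [w] as many as the one at [v];
     adding the equation at the other end of the first diagonal gives one edge in Delta_1. *)
  have S1 : (inr (ordS ord0) \in P) + (inl (ordS ord0, false) \in P)
      + (inl (ord_pred (ordS ord0), true) \in P) = 1.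
    rewrite predS.
    have := Pi ord0 (~~ turn (@ord0 (len z)));
      rewrite !xpair_eqE eq_negb !andbF => /(_ isT isT).
    move: good Pv Pw; rewrite /first_edges /last_edges.
    have [tauP _|tauP] := boolP (tau_band z \in P).
      rewrite /=; case: (turn ord0); case: (turn _) => /=;
      case: (inl (ord0, false) \in P); case: (inl (ord_max, true) \in P);
      case: (inl (ordS ord0, false) \in P); case: (inl (ord0, true) \in P);
        case: (inr (ordS ord0) \in P) => //.
    rewrite first_sideE // last_sideE // /first_edges /last_edges /=.
    case: (turn ord0); case: (turn (ordS ord0)) => /=;
      case: (inl (ord0, false) \in P); case: (inl (ord_max, true) \in P);
      case: (inl (ordS ord0, false) \in P); case: (inl (ord0, true) \in P);
        case: (inr (ordS ord0) \in P) => //=;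
      by case: count.
  have PS : forall i, (inr i \in P) + (inl (i, false) \in P)
             + (inl (ord_pred i, true) \in P) = 1.
    (* The equation at [v] is the count for Delta_0, [S1] gives the step to Delta_1, and [sum]
       propagates it up to the last triangle. *)
    apply: (@ordS_ind _ _ ord0) => [|i Si]; first by rewrite ord_pred0.
    case: (eqVneq i ord0) => [-> // | i0].
    case: (eqVneq i ord_max) => [-> | im]; first by rewrite ordS_max ord_pred0.
    by have := sum i i0 im; rewrite Si predS => -[].
  split=> // i; have := PS (ordS i); rewrite predS => PSi.
  (* The end of a diagonal opposite to [turn ord0] is never glued along the cut, so its equation
     holds for every [i]. *)
  have [s [s0 sm]] : exists s, (i, s) != (ord0, turn (@ord0 (len z))) /\
      (i, s) != (ord_max, turn (@ord0 (len z))).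
    by exists (~~ turn (@ord0 (len z))); rewrite !xpair_eqE eq_negb !andbF.
  exact/(vertex_count _ _ s (PS i) PSi)/(Pi i s s0 sm).
have S0 := PS ord0; rewrite ord_pred0 in S0.
have S1 := PS (ordS ord0); rewrite predS in S1.
have Sm := PS ord_max.
have cF := count_first_edges (conj PS PT).
have cL : count (mem P) (behead last_edges) = (inl (ord_max, true) \in P).
  move: (PT ord_max) Sm; rewrite /last_edges ordS_max [turn ord_max == _]eq_sym;
    case: (_ == _) => /=.
    by case: (_ \in P); case: (_ \in P); case: (_ \in P) => //; case: (_ \in P).
  by case: (_ \in P); case: (_ \in P).
split.
  apply/band_perfectE; split=> [//||i s _ _]; first by rewrite cF cL.
  have PSi := PS (ordS i); rewrite predS in PSi.
  exact/(vertex_count (turn i) (turn (ordS i)) s (PS i) PSi)/PT.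
(* Without tau, exactly one of the other two edges at [v] is chosen, and the counts for [w] show
   that the opposite side of the cut is empty. *)
have [//|tauP] := boolP (tau_band z \in P); rewrite first_sideE // last_sideE //.
rewrite /first_edges /last_edges /= in cF cL *; rewrite cF cL.
move: S0; rewrite [inr ord0 \in P](negPf tauP).
by case: (_ \in P); case: (_ \in P).
Qed.

(** * The minimal matching and the enclosed tiles *)

Lemma on_tileE i (e : edge (snake z)) : on_tile i e =
  match e with
  | inl (i', _) => i' == i
  | inr j => (j == first_third i) || (j == second_third i)
  end.
Proof.
apply/existsP/idP => [[h /existsP[k /andP[kN /eqP <-]]] | eI].
  by rewrite /tile_edge; case: ifP => _; case: h {kN}; rewrite ?eqxx ?orbT.
have tile h k : k != diag_side i h -> tile_edge (snake z) i h k == e ->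
    exists h, [exists k, (k != diag_side i h) && (tile_edge (snake z) i h k == e)].
  by move=> kN ke; exists h; apply/existsP; exists k; rewrite kN.
case: e eI tile => [[i' []] /eqP -> | j /orP[] /eqP ->] tile.
- by apply: (tile true (exit_side (ordS i))); rewrite /tile_edge /= sidesE.
- by apply: (tile false (entry_side i)); rewrite /tile_edge /= sidesE.
- by apply: (tile false (third_side i)); rewrite /tile_edge /= ?sidesE ?eqxx.
- by apply: (tile true (third_side (ordS i))); rewrite /tile_edge /= ?sidesE ?eqxx.
Qed.

Lemma boundary_inl (J : {set 'I_(ncross z)}) i h :
  (inl (i, h) \in boundary_edges J) = (i \in J).
Proof.
rewrite inE (@card_setI_seq _ _ _ [:: i]) //= ?addn0; first by case: (_ \in J).
by move=> i'; rewrite unfold_in on_tileE inE eq_sym.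
Qed.

Lemma first_third_eq i i' : (first_third i == first_third i') = (i == i').
Proof. by []. Qed.

Lemma second_third_eq i i' : (second_third i == second_third i') = (i == i').
Proof. exact: (inj_eq (@lift_inj _ _)). Qed.

Lemma first_third_eq0 i : (first_third i == ord0) = (i == ord0).
Proof. by rewrite -first_third0 first_third_eq. Qed.

Lemma second_third_eq_max i : (second_third i == ord_max) = (i == ord_max).
Proof. by rewrite -second_third_max second_third_eq. Qed.

Lemma second_third_eq0 i : (second_third i == ord0) = false.
Proof. by rewrite eq_sym (negPf (neq_lift _ _)). Qed.

Lemma first_third_eq_max i : (first_third i == ord_max) = false.
Proof. by apply/negbTE; rewrite neq_ltn /= ltn_ord. Qed.

Definition third_eqE :=
  (first_third_eq0, second_third_eq0, first_third_eq_max, second_third_eq_max).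

Lemma boundary_first0 (J : {set 'I_(ncross z)}) :
  (inr ord0 \in boundary_edges J) = (ord0 \in J).
Proof.
rewrite inE (@card_setI_seq _ _ _ [:: ord0]) //= ?addn0; first by case: (_ \in J).
by move=> i; rewrite unfold_in on_tileE inE ![ord0 == _ :> 'I_(ncross z).+1]eq_sym
  !third_eqE orbF.
Qed.

Lemma boundary_last (J : {set 'I_(ncross z)}) :
  (inr ord_max \in boundary_edges J) = (ord_max \in J).
Proof.
rewrite inE (@card_setI_seq _ _ _ [:: ord_max]) //= ?addn0; first by case: (_ \in J).
by move=> i; rewrite unfold_in on_tileE inE ![ord_max == _ :> 'I_(ncross z).+1]eq_sym
  !third_eqE.
Qed.

Lemma boundary_first (J : {set 'I_(ncross z)}) i : i != ord0 ->
  (inr (first_third i) \in boundary_edges J) = (ord_pred i \in J) (+) (i \in J).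
Proof.
move=> i0; rewrite inE (@card_setI_seq _ _ _ [:: ord_pred i; i]) /= ?addn0.
- by case: (_ \in J); case: (_ \in J).
- by rewrite inE ord_pred_neq.
move=> i'; rewrite unfold_in on_tileE !inE first_third_eq -second_third_pred //.
by rewrite second_third_eq orbC eq_sym [i == _]eq_sym.
Qed.

(** Explicit form of [P_minus]. The entry and exit sides chosen are those opposite to the angles of
    [A_minus]; one copy of tau, at the end dictated by the first turn, completes them. *)
Definition minus_edges : {set edge (snake z)} :=
  [set e : edge (snake z) | match e with
    | inl (i, h) => if h then ~~ turn (ordS i) else turn i
    | inr j => (j == ord0) && ~~ turn (@ord0 (len z)) || (j == ord_max) && turn (@ord0
      (len z))
    end].

Lemma thirdP (j : 'I_(ncross z).+1) : j = ord0 \/ exists i, j = second_third i.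
Proof. by case: (unliftP ord0 j) => [i ->|->]; [right; exists i | left]. Qed.

(** At each diagonal, the right end is covered from the first half of the tile and the left end from
    the second half. *)
Lemma minus_perfect : perfect_matching minus_edges.
Proof.
apply/snake_perfectE => -[[i s]|[]]; last 2 first.
- by rewrite /= !inE /= eqxx ordS_max; case: (turn _).
- by rewrite /= !inE /= ; case: (turn _).
rewrite /edges_at count_cat.
have -> : count (mem minus_edges)
     (if s == turn i then
       inr (first_third i) :: (if i == ord0 then [::] else [:: inl (ord_pred i, true)])
     else [:: inl (i, false)]) = ~~ s.
  case: (eqVneq s) => [-> | sN] /=; last by rewrite inE addn0; case: s (turn i) sN => -[].
  rewrite inE !third_eqE; case: (eqVneq i ord0) => [-> | _] /=; first by rewrite orbF addn0.
  by rewrite inE ord_predK addn0.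
have -> : count (mem minus_edges)
     (if s == turn (ordS i) then
          inr (second_third i) :: (if i == ord_max then [::] else [:: inl (ordS i, false)])
        else [:: inl (i, true)]) = s.
  case: (eqVneq s) => [-> | sN] /=; last by rewrite inE addn0; case: s (turn _) sN => -[].
  rewrite inE !third_eqE; case: (eqVneq i ord_max) => [-> | _] /=;
    first by rewrite addn0 ordS_max.
  by rewrite inE addn0.
by case: s.
Qed.

Lemma minus_boundary : minus_edges \subset boundary_edges setT.
Proof.
apply/subsetP => -[[i h]|j]; first by rewrite boundary_inl in_setT.
rewrite inE => /orP[] /andP[/eqP -> _].
  by rewrite boundary_first0 in_setT.
by rewrite boundary_last in_setT.
Qed.

Lemma minus_clockwise (Q : {set edge (snake z)}) : (clockwise_edge z \in Q) =
  if turn (@ord0 (len z)) then inl (ord0, false) \in Q else inr ord0 \in Q.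
Proof.
rewrite /clockwise_edge rotationE /tile_edge; case: (turn _) => /=.
  by rewrite sidesE.
by rewrite eqxx first_third0.
Qed.

(** Being on the boundary excludes all third sides shared by two tiles. The clockwise edge then
    settles the equation at [v], and the vertex equations determine one tile after the other. *)
Lemma minus_unique (Q : {set edge (snake z)}) : perfect_matching Q ->
  Q \subset boundary_edges setT -> clockwise_edge z \in Q -> Q = minus_edges.
Proof.
move=> /snake_perfectE Q1 /subsetP QB; rewrite minus_clockwise => Qc.
have inner i : i != ord_max -> (inr (second_third i) \in Q) = false.
  move=> im; apply/negP => /QB; rewrite -[i]ordSK second_third_pred ?eq_ordS0 //.
  by rewrite boundary_first ?eq_ordS0 // !in_setT.
(* [G i] and [B i] are the two-edge blocks of [edges_at] in the halves of tile [i]; the factors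
   erase the edges missing at the ends of the snake. *)
pose G i := (inr (first_third i) \in Q) + (i != ord0) * (inl (ord_pred i, true) \in Q).
pose B i := (inr (second_third i) \in Q) + (i != ord_max) * (inl (ordS i, false) \in Q).
have count_edges i s : (if s == turn i then G i else (inl (i, false) \in Q : nat)) +
    (if s == turn (ordS i) then B i else (inl (i, true) \in Q : nat)) = 1.
  rewrite -(Q1 (inl (i, s))) /= count_cat /G /B; congr (_ + _).
    by case: ifP => _ /=; rewrite ?addn0 //; case: eqP => /=; rewrite ?mul0n ?mul1n ?addn0.
  by case: ifP => _ /=; rewrite ?addn0 //; case: eqP => /=; rewrite ?mul0n ?mul1n ?addn0.
have step i : G i = ~~ turn i -> (inl (i, false) \in Q) = turn i ->
    B i = turn (ordS i) /\ (inl (i, true) \in Q) = ~~ turn (ordS i).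
  move=> Gi ei; move: (count_edges i true) (count_edges i false); rewrite Gi ei.
  by move: (B i) => b; case: (turn i); case: (turn (ordS i));
    case: (inl (i, true) \in Q); case: b => [|[|b]].
have base : G ord0 = ~~ turn (@ord0 (len z)) /\
    (inl (ord0, false) \in Q) = turn (@ord0 (len z)).
  rewrite /G eqxx mul0n addn0 first_third0.
  move: (Q1 (inr false)) Qc; rewrite /= addn0.
  by case: (turn _); case: (_ \in Q); case: (_ \in Q).
have all i : G i = ~~ turn i /\ (inl (i, false) \in Q) = turn i.
  move: i; apply: (ordS_ind base) => i [Gi ei].
  have [im | im] := eqVneq i ord_max; first by rewrite im ordS_max.
  have [Bi xi] := step i Gi ei.
  move: Bi; rewrite /B /G inner // im mul1n ordSK eq_ordS0 im xi mul1n.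
  rewrite -second_third_pred ?eq_ordS0 // ordSK inner // !add0n.
  by split=> //; case: (turn _) Bi; case: (_ \in Q).
apply/setP => e; rewrite inE; case: e => [[i []] | j].
- by have [Gi ei] := all i; have [] := step i Gi ei.
- by have [] := all i.
case: (thirdP j) => [-> | [i ->]].
  have := proj1 (all ord0); rewrite /G eqxx mul0n addn0 first_third0 eqxx /= orbF.
  by case: (turn _); case: (_ \in Q).
rewrite !third_eqE /=; have [-> | im] := eqVneq i ord_max; last exact: inner.
have [Gi ei] := all ord_max; have [] := step _ Gi ei.
by rewrite /B eqxx mul0n addn0 ordS_max; case: (turn _); case: (_ \in Q).
Qed.

Lemma P_minusE : P_minus z = minus_edges.
Proof.
rewrite /P_minus; case: pickP => [Q /and3P[] | /(_ minus_edges)] /=.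
  exact: minus_unique.
rewrite minus_perfect minus_boundary minus_clockwise /=.
by rewrite !inE eqxx; case: (turn _).
Qed.

Lemma in_symdiff (U : finType) (A B : {set U}) e :
  (e \in symdiff A B) = (e \in A) (+) (e \in B).
Proof. by rewrite !inE; case: (e \in A); case: (e \in B). Qed.

Lemma extend_inl (P : {set edge (band z)}) a : (inl a \in extend P) = (inl a \in P).
Proof. by rewrite /extend; do 2? case: ifP => _; rewrite !inE. Qed.

Lemma extend_inner (P : {set edge (band z)}) i : i != ord0 ->
  (inr (first_third i) \in extend P) = (inr i \in P).
Proof.
move=> i0; rewrite /extend; do 2? case: ifP => _;
  by rewrite !inE ?eq_inr snake_to_bandE ?third_eqE ?(negPf i0).
Qed.

(** In the snake graph [v] and [v'] have two edges each, a copy of tau and one other; the extension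
    contains the copy exactly where the other edge is missing. *)
Lemma extend_ends (P : {set edge (band z)}) : matching_coherent P ->
  (inr ord0 \in extend P) = (inl (ord0, false) \notin P) /\
  (inr ord_max \in extend P) = (inl (ord_max, true) \notin P).
Proof.
move=> cP; have [PS PT] := cP; have := PS ord0; rewrite ord_pred0 => S0.
have b0 : snake_to_band (inr ord0 : edge (snake z)) = tau_band z.
  by rewrite -first_third0 snake_to_bandE.
have bm : snake_to_band (inr ord_max : edge (snake z)) = tau_band z.
  by rewrite -second_third_max snake_to_bandE ordS_max.
rewrite /extend; move: S0; rewrite -/(tau_band z).
case: (boolP (tau_band z \in P)) => tauP.
  rewrite !inE b0 bm tauP.
  by case: (inl (ord0, false) \in P); case: (inl (ord_max, true) \in P).
rewrite last_sideE // /first_edges /= -/(behead first_edges) count_first_edges //.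
have cut0 : (inr ord0 \in cut P) = false by rewrite inE b0 (negPf tauP).
have cutm : (inr ord_max \in cut P) = false by rewrite inE bm (negPf tauP).
by case: (inl (ord0, false) \in P); case: (inl (ord_max, true) \in P) => //= _;
  split; rewrite in_setU1 ?cut0 ?cutm ?orbF; apply/eqP.
Qed.

(** The edge [inl (i, false)] lies on tile [i] only, so any solution is read off from these edges.
    That the resulting set is a solution is checked on the other edges, where coherence is used. *)
Lemma enclosed_tilesE (P : {set edge (band z)}) : matching_coherent P ->
  enclosed_tiles P = [set i | (inl (i, false) \in P) != turn i].
Proof.
move=> cP; have [PS PT] := cP; have [E0 Em] := extend_ends cP.
rewrite /enclosed_tiles P_minusE;
  case: pickP => [J /eqP/setP JE | /(_ [set i | (inl (i, false) \in P) != turn i])] /=.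
  apply/setP => i; have := JE (inl (i, false)).
  rewrite boundary_inl in_symdiff extend_inl !inE => ->.
  by case: (turn i); case: (_ \in P).
case/eqP; apply/setP => e; rewrite in_symdiff [e \in minus_edges]inE;
  case: e => [[i []] | j].
- rewrite boundary_inl extend_inl inE; move: (PT i).
  by case: (turn i); case: (turn _); case: (_ \in P); case: (_ \in P).
- by rewrite boundary_inl extend_inl inE; case: (turn i); case: (_ \in P).
have [->|[i ->]] := thirdP j.
  rewrite boundary_first0 E0 inE /= orbF.
  by case: (turn _); case: (_ \in P).
rewrite !third_eqE /=; have [-> | im] := eqVneq i ord_max.
  rewrite second_third_max boundary_last Em inE; move: (PT ord_max); rewrite ordS_max.
  by case: (turn _); case: (turn _); case: (_ \in P); case: (_ \in P).
have i0 : ordS i != ord0 by rewrite eq_ordS0.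
have := second_third_pred i0; rewrite ordSK => ->.
rewrite boundary_first // extend_inner // !inE ordSK.
move: (PS (ordS i)) (PT i); rewrite ordSK.
by case: (turn _); case: (turn _); do 4! case: (_ \in P).
Qed.

(** * The bijection *)

Definition edge_angle (e : edge (band z)) : angle z :=
  match e with
  | inl (i, h) => if h then (ordS i, exit_side (ordS i)) else (i, entry_side i)
  | inr j => (j, third_side j)
  end.

Definition angle_edge (a : angle z) : edge (band z) :=
  if a.2 == third_side a.1 then inr a.1
  else if a.2 == entry_side a.1 then inl (a.1, false)
  else inl (ord_pred a.1, true).

Lemma edge_angleK : cancel edge_angle angle_edge.
Proof. by case=> [[i []]|j]; rewrite /angle_edge /= ?sidesE ?eqxx ?ordSK. Qed.

Lemma angle_edgeK : cancel angle_edge edge_angle.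
Proof.
case=> j k; rewrite /angle_edge /=.
by case: (sideP j k); rewrite ?sidesE ?eqxx //= ord_predK.
Qed.

Lemma mem_edge_angle (P : {set edge (band z)}) e :
  (edge_angle e \in edge_angle @: P) = (e \in P).
Proof. exact/mem_imset/can_inj/edge_angleK. Qed.

Lemma edge_angle_coherent (P : {set edge (band z)}) :
  coherent (edge_angle @: P) <-> matching_coherent P.
Proof.
have E j : ((j, entry_side j) \in edge_angle @: P) = (inl (j, false) \in P).
  exact: (mem_edge_angle P (inl (j, false))).
have X j : ((ordS j, exit_side (ordS j)) \in edge_angle @: P) = (inl (j, true) \in P).
  exact: (mem_edge_angle P (inl (j, true))).
have X' j : ((j, exit_side j) \in edge_angle @: P) = (inl (ord_pred j, true) \in P).
  by rewrite -X ord_predK.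
have H j : ((j, third_side j) \in edge_angle @: P) = (inr j \in P).
  exact: (mem_edge_angle P (inr j)).
by split=> -[hS hT]; split=> j; move: (hS j) (hT j);
  rewrite ?E ?X ?H ?X'; case: (inr j \in P); case: (_ \in P); case: (_ \in P).
Qed.

Lemma good_edge_angle (P : {set edge (band z)}) :
  (edge_angle @: P \in good_angle_matchings z) = (P \in good_matchings z).
Proof.
by apply/good_angle_matchingsP/good_matchingsP => /edge_angle_coherent.
Qed.

Lemma x_matching_edge_angle (F : fieldType) (f : 'I_N -> F) (P : {set edge (band z)}) :
  x_matching f P = x_angles f (edge_angle @: P).
Proof.
rewrite /x_angles big_imset /=; last by move=> e e' _ _; apply/can_inj/edge_angleK.
by apply: eq_bigr => -[[i []]|j].
Qed.

(** The only exterior angles with the [i]-th diagonal as a side are E_i and X_(i+1). By coherence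
    both differ from [A_minus] or neither does, and the condition on E_i is the one defining the
    enclosed tiles. *)
Lemma y_matching_edge_angle (F : fieldType) (f : 'I_N -> F) (P : {set edge (band z)}) :
  P \in good_matchings z -> y_matching f P = y_angles f (edge_angle @: P).
Proof.
move=> /good_matchingsP cP; have [PS PT] := cP.
rewrite /y_matching enclosed_tilesE // /y_angles; apply: eq_bigl => i.
have E : ((i, entry_side i) \in symdiff (A_minus z) (edge_angle @: P))
    = ((inl (i, false) \in P) != turn i).
  rewrite in_symdiff inE min_conditionE (mem_edge_angle P (inl (i, false))).
  by case: (turn i); rewrite ?sidesE ?eqxx; case: (_ \in P).
have X : ((ordS i, exit_side (ordS i)) \in symdiff (A_minus z) (edge_angle @: P))
    = ((inl (i, false) \in P) != turn i).
  rewrite in_symdiff inE min_conditionE (mem_edge_angle P (inl (i, true))).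
  move: (PT i); case: (turn i); case: (turn (ordS i)); rewrite ?sidesE ?eqxx;
  by case: (_ \in P); case: (_ \in P).
rewrite inE; apply/idP/exists_inP => [e | [[j k] aD /andP[kN]]].
  exists (i, entry_side i); first by rewrite E.
  by rewrite /exterior /diagonal_of /= eqxx !sidesE.
rewrite /exterior /= in kN; rewrite /diagonal_of /= => /orP[] /andP[/eqP ji].
  by rewrite -ji; case: (sideP j k) aD kN; rewrite ?eqxx // ji E.
by rewrite -ji; case: (sideP j k) aD kN; rewrite ?eqxx // ji X.
Qed.

End Graphs.

Import GRing.Theory.
Local Open Scope ring_scope.

Theorem theorem6p5 (N : nat) (T : triangulation N) (z : essential_loop T) :
  exists psi : {P | P \in good_matchings z} ->
               {A | A \in good_angle_matchings z},
    bijective psi /\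
    forall (F : fieldType) (x y : 'I_N -> F), (forall i, x i != 0) ->
      (forall P, x_matching x (val P) = x_angles x (val (psi P)) /\
                 y_matching y (val P) = y_angles y (val (psi P))) /\
      x_loop z x y =
        (cross z x)^-1 *
          \sum_(A in good_angle_matchings z) x_angles x A * y_angles y A.
Proof.
have good P : P \in good_matchings z -> @edge_angle _ _ z @: P \in good_angle_matchings z.
  by rewrite good_edge_angle.
have angle_edgeKs (A : {set angle z}) : @edge_angle _ _ z @: (@angle_edge _ _ z @: A) = A.
  by rewrite -imset_comp (eq_imset _ (@angle_edgeK _ _ z)) imset_id.
have edge_angleKs (P : {set edge (band z)})
  : @angle_edge _ _ z @: (@edge_angle _ _ z @: P) = P.
  by rewrite -imset_comp (eq_imset _ (@edge_angleK _ _ z)) imset_id.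
have good' A : A \in good_angle_matchings z -> @angle_edge _ _ z @: A \in good_matchings z.
  by rewrite -good_edge_angle angle_edgeKs.
pose psi (P : {P | P \in good_matchings z}) : {A | A \in good_angle_matchings z} :=
  exist (fun A => A \in good_angle_matchings z) _ (good _ (valP P)).
exists psi; split.
  exists (fun A => exist (fun P => P \in good_matchings z) _ (good' _ (valP A))) =>
    -[B gB]; apply: val_inj => /=.
    exact: edge_angleKs.
  exact: angle_edgeKs.
move=> F x y _; split=> [[P gP] /=|].
  by rewrite x_matching_edge_angle y_matching_edge_angle.
(* Taking images under [edge_angle] is a bijection between all sets of edges and all sets of angles,
   so the sum is reindexed before restricting to good matchings. *)
congr (_ * _); rewrite [RHS](reindex (fun P : {set edge (band z)} =>
  @edge_angle _ _ z @: P)) /=; last first.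
  exact/onW_bij/(Bijective edge_angleKs angle_edgeKs).
apply: eq_big => [P | P gP]; first by rewrite good_edge_angle.
by rewrite x_matching_edge_angle y_matching_edge_angle.
Qed.
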